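(* Let $\mathcal A$ be a Krull-Schmidt additive category and let $\mathcal B\subset\mathcal A$ be a full additive subcategory closed under summands. Let $e:\mathcal B\to\mathcal A$ be the inclusion and $s:\mathcal A\to\mathcal A/\mathcal B$ the quotient functor. Then the sequence $$K_1(\mathcal B)\xrightarrow{K_1(e)}K_1(\mathcal A)\xrightarrow{K_1(s)}K_1(\mathcal A/\mathcal B)\xrightarrow{\ 0\ }K_0(\mathcal B)\xrightarrow{K_0(e)}K_0(\mathcal A)\xrightarrow{K_0(s)}K_0(\mathcal A/\mathcal B)\to0$$ is exact.
   Context: An additive category is Krull-Schmidt if every object is a finite direct sum of objects with local endomorphism rings. $\mathcal A/\mathcal B$ is the additive quotient of $\mathcal A$ by the ideal of morphisms factoring through an object of $\mathcal B$. All additive categories here are regarded as exact categories with the split exact structure (conflations are the sequences isomorphic to $A\to A\oplus B\to B$), and $K_0$, $K_1$ are taken with respect to this structure. *)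

(* Defs.v *)
From HB Require Import structures.
From mathcomp Require Import all_boot all_order all_algebra.
From mathcomp Require Import generic_quotient ring_quotient.
From mathcomp Require Import boolp.
From mathcomp.multinomials Require Import freeg.

Set Implicit Arguments.
Unset Strict Implicit.
Unset Printing Implicit Defensive.

Import GRing.Theory.
Import Quotient.
Local Open Scope ring_scope.
Local Open Scope quotient_scope.

(* Exactness at [Y] of [X -> Y -> Z], where [z0] is the neutral element of     *)
(* [Z]; the groups may be multiplicative (K_1) or additive (K_0).              *)
Definition exact_at (X Y Z : Type) (z0 : Z) (f : X -> Y) (g : Y -> Z) : Prop :=
  forall y, g y = z0 <-> exists x, f x = y.

(******************************************************************************)
(* Additive categories                                                        *)
(******************************************************************************)

Record preaddCat := PreaddCat {
  ob :> Type;
  hom : ob -> ob -> zmodType;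
  idm : forall X, hom X X;
  comp : forall X Y Z, hom Y Z -> hom X Y -> hom X Z;
  compA : forall X Y Z T (h : hom Z T) (g : hom Y Z) (f : hom X Y),
    comp h (comp g f) = comp (comp h g) f;
  comp1m : forall X Y (f : hom X Y), comp (idm Y) f = f;
  compm1 : forall X Y (f : hom X Y), comp f (idm X) = f;
  compDl : forall X Y Z (g g' : hom Y Z) (f : hom X Y),
    comp (g + g') f = comp g f + comp g' f;
  compDr : forall X Y Z (g : hom Y Z) (f f' : hom X Y),
    comp g (f + f') = comp g f + comp g f'
}.

Arguments idm {p} X.
Arguments comp {p X Y Z} g f.
Notation "g \\o f" := (comp g f) (at level 40, left associativity).

Section Preadditive.
Variable A : preaddCat.
Implicit Types X Y Z W : A.

Lemma comp0m X Y Z (f : hom X Y) : (0 : hom Y Z) \\o f = 0.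
Proof. by apply: (addrI (0 \\o f)); rewrite -compDl !addr0. Qed.

Lemma compm0 X Y Z (g : hom Y Z) : g \\o (0 : hom X Y) = 0.
Proof. by apply: (addrI (g \\o 0)); rewrite -compDr !addr0. Qed.

Lemma compNm X Y Z (g : hom Y Z) (f : hom X Y) : (- g) \\o f = - (g \\o f).
Proof. by apply: (addrI (g \\o f)); rewrite -compDl !subrr comp0m. Qed.

Lemma compmN X Y Z (g : hom Y Z) (f : hom X Y) : g \\o (- f) = - (g \\o f).
Proof. by apply: (addrI (g \\o f)); rewrite -compDr !subrr compm0. Qed.

Definition isom X Y (f : hom X Y) : Prop :=
  exists g : hom Y X, g \\o f = idm X /\ f \\o g = idm Y.

Definition zero_object Z : Prop :=
  (forall X (f : hom X Z), f = 0) /\ (forall X (f : hom Z X), f = 0).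

Definition biproduct X Y W (i1 : hom X W) (i2 : hom Y W)
    (p1 : hom W X) (p2 : hom W Y) : Prop :=
  [/\ p1 \\o i1 = idm X, p2 \\o i2 = idm Y, p1 \\o i2 = 0, p2 \\o i1 = 0
    & i1 \\o p1 + i2 \\o p2 = idm W].

Definition direct_sum n (X : 'I_n -> A) W
    (i : forall k, hom (X k) W) (p : forall k, hom W (X k)) : Prop :=
  [/\ forall k, p k \\o i k = idm (X k),
      forall k l, k != l -> p k \\o i l = 0
    & \sum_(k < n) i k \\o p k = idm W].

(* The ring End(X) is local: it is nonzero and a sum of two nonunits is a      *)
(* nonunit.                                                                    *)
Definition local_end X : Prop :=
  idm X <> 0 /\
  forall f g : hom X X, ~ isom f -> ~ isom g -> ~ isom (f + g).

Definition krull_schmidt : Prop :=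
  forall W, exists n (X : 'I_n -> A) (i : forall k, hom (X k) W)
    (p : forall k, hom W (X k)),
    direct_sum i p /\ forall k, local_end (X k).

(* The split exact structure: [X -i-> Y -p-> Z] is a conflation iff it is      *)
(* isomorphic to some [A1 -> A1 (+) A2 -> A2].                                 *)
Definition conflation X Y Z (i : hom X Y) (p : hom Y Z) : Prop :=
  exists A1 A2 W (i1 : hom A1 W) (i2 : hom A2 W) (p1 : hom W A1)
    (p2 : hom W A2) (a : hom X A1) (b : hom Y W) (c : hom Z A2),
    biproduct i1 i2 p1 p2 /\
    [/\ isom a, isom b, isom c, b \\o i = i1 \\o a & c \\o p = p2 \\o b].

End Preadditive.

(* A zero object is chosen since it serves as the base point for K_1.          *)
Record addCat := AddCat {
  addCat_pre :> preaddCat;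
  zob : addCat_pre;
  zobP : zero_object zob;
  biproductP : forall X Y : addCat_pre,
    exists W (i1 : hom X W) (i2 : hom Y W) (p1 : hom W X) (p2 : hom W Y),
      biproduct i1 i2 p1 p2
}.

Arguments zob : clear implicits.

Record addFunctor (A B : addCat) := AddFunctor {
  fob :> A -> B;
  fhom : forall X Y, hom X Y -> hom (fob X) (fob Y);
  fhom1 : forall X, fhom (idm X) = idm (fob X);
  fhomM : forall X Y Z (g : hom Y Z) (f : hom X Y),
    fhom (g \\o f) = fhom g \\o fhom f;
  fhomD : forall X Y (f g : hom X Y), fhom (f + g) = fhom f + fhom g
}.

Arguments fhom {A B} F {X Y} f : rename.

Section AddFunctorTheory.
Variables (A B : addCat) (F : addFunctor A B).

Lemma fhom0 (X Y : A) : fhom F (0 : hom X Y) = 0.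
Proof. by apply: (addrI (fhom F 0)); rewrite -fhomD !addr0. Qed.

Lemma fhom_isom (X Y : A) (f : hom X Y) : isom f -> isom (fhom F f).
Proof.
by case=> g [gf fg]; exists (fhom F g); rewrite -!fhomM gf fg !fhom1.
Qed.

Lemma fhom_biproduct (X Y W : A) (i1 : hom X W) (i2 : hom Y W)
    (p1 : hom W X) (p2 : hom W Y) :
  biproduct i1 i2 p1 p2 ->
  biproduct (fhom F i1) (fhom F i2) (fhom F p1) (fhom F p2).
Proof.
by case=> e1 e2 e3 e4 e5; split; rewrite -!fhomM -?fhomD ?e1 ?e2 ?e3 ?e4 ?e5
  ?fhom1 ?fhom0.
Qed.

Lemma fhom_conflation (X Y Z : A) (i : hom X Y) (p : hom Y Z) :
  conflation i p -> conflation (fhom F i) (fhom F p).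
Proof.
move=> [A1 [A2 [W [i1 [i2 [p1 [p2 [a [b [c [bp [ia ib ic e1 e2]]]]]]]]]]]].
exists (F A1), (F A2), (F W), (fhom F i1), (fhom F i2), (fhom F p1), (fhom F p2),
  (fhom F a), (fhom F b), (fhom F c); split; first exact: fhom_biproduct.
by split; do ?[exact: fhom_isom]; rewrite -!fhomM ?e1 ?e2.
Qed.

End AddFunctorTheory.

(******************************************************************************)
(* Full additive subcategories and the additive quotient                      *)
(******************************************************************************)

Record addSubcat (A : addCat) := AddSubcat {
  sub_ob :> A -> Prop;
  sub_zob : sub_ob (zob A);
  sub_biproduct : forall X Y, sub_ob X -> sub_ob Y ->
    exists W (i1 : hom X W) (i2 : hom Y W) (p1 : hom W X) (p2 : hom W Y),
      sub_ob W /\ biproduct i1 i2 p1 p2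
}.

(* Taking X or Y to be a zero object, this includes closure under isomorphism. *)
Definition summand_closed (A : addCat) (B : addSubcat A) : Prop :=
  forall (X Y W : A) (i1 : hom X W) (i2 : hom Y W) (p1 : hom W X) (p2 : hom W Y),
    biproduct i1 i2 p1 p2 -> B W -> B X /\ B Y.

Section FullSubcategory.
Variables (A : addCat) (B : addSubcat A).

Definition fullsub_pre : preaddCat :=
  @PreaddCat {X : A | B X} (fun X Y => hom (sval X) (sval Y))
    (fun X => idm (sval X)) (fun X Y Z g f => g \\o f)
    (fun _ _ _ _ => @compA A _ _ _ _) (fun _ _ => @comp1m A _ _)
    (fun _ _ => @compm1 A _ _) (fun _ _ _ => @compDl A _ _ _)
    (fun _ _ _ => @compDr A _ _ _).

Definition fullsub_zob : fullsub_pre := exist _ (zob A) (sub_zob B).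

Fact fullsub_zobP : zero_object fullsub_zob.
Proof. by have [h1 h2] := zobP A; split=> X f; [exact: h1|exact: h2]. Qed.

Fact fullsub_biproductP (X Y : fullsub_pre) :
  exists W (i1 : hom X W) (i2 : hom Y W) (p1 : hom W X) (p2 : hom W Y),
    biproduct i1 i2 p1 p2.
Proof.
have [W [i1 [i2 [p1 [p2 [BW bp]]]]]] := sub_biproduct (svalP X) (svalP Y).
by exists (exist _ W BW), i1, i2, p1, p2.
Qed.

Definition fullsub : addCat := AddCat fullsub_zobP fullsub_biproductP.

Definition inclusion : addFunctor fullsub A :=
  @AddFunctor fullsub A (fun X => sval X) (fun _ _ f => f)
    (fun _ => erefl) (fun _ _ _ _ _ => erefl) (fun _ _ _ _ => erefl).

End FullSubcategory.

Section AdditiveQuotient.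
Variables (A : addCat) (B : addSubcat A).

Definition factors_through (X Y : A) (f : hom X Y) : Prop :=
  exists Z (g : hom X Z) (h : hom Z Y), B Z /\ f = h \\o g.

Definition ideal (X Y : A) : {pred hom X Y} :=
  [pred f | `[< factors_through f >]].

Fact ideal_zmod_closed X Y : zmod_closed (@ideal X Y).
Proof.
split=> [|f f' /asboolP[Z [g [h [BZ ->]]]] /asboolP[Z' [g' [h' [BZ' ->]]]]].
  apply/asboolP; exists (zob A), 0, 0; split; first exact: sub_zob.
  by rewrite comp0m.
have [W [i1 [i2 [p1 [p2 [BW [e1 e2 e3 e4 _]]]]]]] := sub_biproduct BZ BZ'.
apply/asboolP; exists W, (i1 \\o g + i2 \\o g'), (h \\o p1 - h' \\o p2).
split=> //; rewrite compDl !compDr !compNm !compA -!(compA _ p1) -!(compA _ p2).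
by rewrite e1 e2 e3 e4 !compm0 !compm1 !comp0m oppr0 addr0 add0r.
Qed.

HB.instance Definition _ (X Y : A) :=
  GRing.isZmodClosed.Build (hom X Y) (@ideal X Y) (ideal_zmod_closed X Y).

Definition quot_hom (X Y : A) : zmodType := {quot @ideal X Y}.

Definition to_quot (X Y : A) (f : hom X Y) : quot_hom X Y :=
  \pi_(quot_hom X Y) f.

Definition quot_comp (X Y Z : A) (g : quot_hom Y Z) (f : quot_hom X Y) :
    quot_hom X Z :=
  to_quot (repr g \\o repr f).

Lemma to_quotD (X Y : A) (f g : hom X Y) :
  to_quot (f + g) = to_quot f + to_quot g.
Proof. by rewrite /to_quot raddfD. Qed.

Lemma to_quot_eqP (X Y : A) (f g : hom X Y) :
  to_quot f = to_quot g <-> factors_through (f - g).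
Proof.
by split=> [/eqP|/asboolP fg]; [|apply/eqP]; rewrite -idealrBE // => /asboolP.
Qed.

Lemma to_quotM (X Y Z : A) (g : hom Y Z) (f : hom X Y) :
  quot_comp (to_quot g) (to_quot f) = to_quot (g \\o f).
Proof.
have /to_quot_eqP[Z1 [a [b [BZ1 e1]]]] :
  to_quot (repr (to_quot g)) = to_quot g by rewrite /to_quot reprK.
have /to_quot_eqP[Z2 [c [d [BZ2 e2]]]] :
  to_quot (repr (to_quot f)) = to_quot f by rewrite /to_quot reprK.
transitivity (to_quot (repr (to_quot g) \\o f)); apply/to_quot_eqP.
  exists Z2, c, (repr (to_quot g) \\o d).
  by rewrite -compA -e2 compDr compmN.
by exists Z1, (a \\o f), b; rewrite compA -e1 compDl compNm.
Qed.

Lemma to_quot_surj (X Y : A) (f : quot_hom X Y) : exists g, f = to_quot g.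
Proof. by exists (repr f); rewrite /to_quot reprK. Qed.

Fact quot_compA (X Y Z T : A)
    (h : quot_hom Z T) (g : quot_hom Y Z) (f : quot_hom X Y) :
  quot_comp h (quot_comp g f) = quot_comp (quot_comp h g) f.
Proof.
have [f' ->] := to_quot_surj f; have [g' ->] := to_quot_surj g.
by have [h' ->] := to_quot_surj h; rewrite !to_quotM compA.
Qed.

Fact quot_comp1m (X Y : A) (f : quot_hom X Y) :
  quot_comp (to_quot (idm Y)) f = f.
Proof. by have [f' ->] := to_quot_surj f; rewrite to_quotM comp1m. Qed.

Fact quot_compm1 (X Y : A) (f : quot_hom X Y) :
  quot_comp f (to_quot (idm X)) = f.
Proof. by have [f' ->] := to_quot_surj f; rewrite to_quotM compm1. Qed.

Fact quot_compDl (X Y Z : A) (g g' : quot_hom Y Z) (f : quot_hom X Y) :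
  quot_comp (g + g') f = quot_comp g f + quot_comp g' f.
Proof.
have [f' ->] := to_quot_surj f; have [h ->] := to_quot_surj g.
have [h' ->] := to_quot_surj g'.
by rewrite -to_quotD !to_quotM compDl to_quotD.
Qed.

Fact quot_compDr (X Y Z : A) (g : quot_hom Y Z) (f f' : quot_hom X Y) :
  quot_comp g (f + f') = quot_comp g f + quot_comp g f'.
Proof.
have [h ->] := to_quot_surj g; have [k ->] := to_quot_surj f.
have [k' ->] := to_quot_surj f'.
by rewrite -to_quotD !to_quotM compDr to_quotD.
Qed.

Definition addquot_pre : preaddCat :=
  PreaddCat quot_compA quot_comp1m quot_compm1 quot_compDl quot_compDr.

Fact addquot_zobP : @zero_object addquot_pre (zob A).
Proof.
have [h1 h2] := zobP A; split=> X f; have [g ->] := to_quot_surj f;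
  by rewrite ?(h1 _ g) ?(h2 _ g) /to_quot raddf0.
Qed.

Fact addquot_biproductP (X Y : addquot_pre) :
  exists W (i1 : hom X W) (i2 : hom Y W) (p1 : hom W X) (p2 : hom W Y),
    biproduct i1 i2 p1 p2.
Proof.
have [W [i1 [i2 [p1 [p2 [e1 e2 e3 e4 e5]]]]]] := biproductP (X : A) (Y : A).
exists W, (to_quot i1), (to_quot i2), (to_quot p1), (to_quot p2).
by split; rewrite /= ?to_quotM ?e1 ?e2 ?e3 ?e4 -?to_quotD ?e5 // /to_quot raddf0.
Qed.

Definition addquot : addCat := AddCat addquot_zobP addquot_biproductP.

Fact to_quotM_sym (X Y Z : A) (g : hom Y Z) (f : hom X Y) :
  to_quot (g \\o f) = quot_comp (to_quot g) (to_quot f).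
Proof. by rewrite to_quotM. Qed.

Definition quotient_functor : addFunctor A addquot :=
  @AddFunctor A addquot (fun X => X) to_quot
    (fun _ => erefl) to_quotM_sym to_quotD.

End AdditiveQuotient.

(******************************************************************************)
(* K_0: the free abelian group on the objects modulo [Y] = [X] + [Z] for      *)
(* every conflation X -> Y -> Z                                               *)
(******************************************************************************)

Section K0.
Variable A : addCat.

Definition ob_class (X : A) : {freeg {classic A}} := << (X : {classic A}) >>.

Inductive K0_relation : {freeg {classic A}} -> Prop :=
| K0_rel_conflation (X Y Z : A) (i : hom X Y) (p : hom Y Z) :
    conflation i p -> K0_relation (ob_class Y - (ob_class X + ob_class Z))
| K0_rel0 : K0_relation 0
| K0_relB x y : K0_relation x -> K0_relation y -> K0_relation (x - y).

Definition K0_rel : {pred {freeg {classic A}}} := [pred x | `[< K0_relation x >]].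

Fact K0_rel_zmod_closed : zmod_closed K0_rel.
Proof.
split=> [|x y /asboolP hx /asboolP hy]; apply/asboolP; first exact: K0_rel0.
exact: K0_relB.
Qed.

HB.instance Definition _ :=
  GRing.isZmodClosed.Build {freeg {classic A}} K0_rel K0_rel_zmod_closed.

Definition K0 : zmodType := {quot K0_rel}.

End K0.

Section K0Functor.
Variables (A B : addCat) (F : addFunctor A B).

Definition K0_lift (x : {freeg {classic A}}) : {freeg {classic B}} :=
  fglift (M := zmodule {freeg {classic B}}) (K := {classic A})
    (fun X : {classic A} => ob_class (F X)) x.

Fact K0_liftB : {morph K0_lift : x y / x - y}.
Proof. exact: (@lift_is_additive _ _ (zmodule {freeg {classic B}})). Qed.

Fact K0_lift_class (X : A) : K0_lift (ob_class X) = ob_class (F X).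
Proof. by rewrite /K0_lift liftU scale1r. Qed.

Definition K0_map (x : K0 A) : K0 B := \pi_(K0 B) (K0_lift (repr x)).

Lemma K0_mapE x : K0_map (\pi_(K0 A) x) = \pi_(K0 B) (K0_lift x).
Proof.
apply/eqP; rewrite -idealrBE -K0_liftB.
have: (repr (\pi_(K0 A) x) - x) \in @K0_rel A by rewrite idealrBE reprK.
have L0 : K0_lift 0 = 0 by rewrite -(subrr 0) K0_liftB subrr.
have LD u v : K0_lift (u + v) = K0_lift u + K0_lift v.
  by rewrite -{1}[v]opprK -[- v]sub0r !K0_liftB L0 sub0r opprK.
move=> /asboolP; elim=> [X Y Z i p ip||u v _ /asboolP hu _ /asboolP hv];
  apply/asboolP.
- rewrite K0_liftB LD !K0_lift_class.
  exact: K0_rel_conflation (fhom_conflation F ip).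
- by rewrite L0; exact: K0_rel0.
- by rewrite K0_liftB; exact: K0_relB.
Qed.

Fact K0_map_zmod_morphism : zmod_morphism K0_map.
Proof.
move=> x y; rewrite -[x]reprK -[y]reprK.
by rewrite -raddfB !K0_mapE K0_liftB raddfB.
Qed.

HB.instance Definition _ :=
  GRing.isZmodMorphism.Build (K0 A) (K0 B) K0_map K0_map_zmod_morphism.

End K0Functor.

(******************************************************************************)
(* The (edge-path) fundamental group of a simplicial set; it only depends on  *)
(* the simplices of dimension at most 2                                       *)
(******************************************************************************)

(* [face a b c]: there is a 2-simplex with d_2 = a, d_0 = b and d_1 = c.       *)
(* Degenerate edges need no separate treatment below: a degenerate 2-simplex   *)
(* gives [face a a a] for the degenerate edge a at u, which makes it trivial.  *)
Record sset2 := Sset2 {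
  vert :> Type;
  edge : vert -> vert -> Type;
  face : forall u v w, edge u v -> edge v w -> edge u w -> Prop
}.

Section EdgePaths.
Variable S : sset2.

Inductive epath : S -> S -> Type :=
| Enil u : epath u u
| Efwd u v w (a : edge u v) (p : epath v w) : epath u w
| Ebwd u v w (a : edge v u) (p : epath v w) : epath u w.

Inductive htpy : forall u v, epath u v -> epath u v -> Prop :=
| htpy_refl u v (p : epath u v) : htpy p p
| htpy_sym u v (p q : epath u v) : htpy p q -> htpy q p
| htpy_trans u v (p q r : epath u v) : htpy p q -> htpy q r -> htpy p r
| htpy_fwd u v w (a : edge u v) (p q : epath v w) :
    htpy p q -> htpy (Efwd a p) (Efwd a q)
| htpy_bwd u v w (a : edge v u) (p q : epath v w) :
    htpy p q -> htpy (Ebwd a p) (Ebwd a q)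
| htpy_fwdK u v w (a : edge u v) (p : epath u w) : htpy (Efwd a (Ebwd a p)) p
| htpy_bwdK u v w (a : edge v u) (p : epath u w) : htpy (Ebwd a (Efwd a p)) p
| htpy_face u v w t (a : edge u v) (b : edge v w) (c : edge u w)
    (p : epath w t) :
    face a b c -> htpy (Efwd a (Efwd b p)) (Efwd c p).

Fixpoint ecat u v w (p : epath u v) : epath v w -> epath u w :=
  match p with
  | Enil _ => fun q => q
  | Efwd _ _ _ a p => fun q => Efwd a (ecat p q)
  | Ebwd _ _ _ a p => fun q => Ebwd a (ecat p q)
  end.

Fixpoint erev u v (p : epath u v) : epath v u :=
  match p with
  | Enil u => Enil u
  | Efwd _ _ _ a p => ecat (erev p) (Ebwd a (Enil _))
  | Ebwd _ _ _ a p => ecat (erev p) (Efwd a (Enil _))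
  end.

Lemma ecatA u v w t (p : epath u v) (q : epath v w) (r : epath w t) :
  ecat p (ecat q r) = ecat (ecat p q) r.
Proof. by elim: p w t q r => //= ? ? ? a p IHp w t q r; rewrite IHp. Qed.

Lemma ecatp0 u v (p : epath u v) : ecat p (Enil v) = p.
Proof. by elim: p => //= ? ? ? a p ->. Qed.

Lemma htpy_catr u v w (p : epath u v) (q q' : epath v w) :
  htpy q q' -> htpy (ecat p q) (ecat p q').
Proof.
elim: p q q' => //= ? ? ? a p IHp q q' qq'.
  exact/htpy_fwd/IHp.
exact/htpy_bwd/IHp.
Qed.

Lemma htpy_catl u v w (p p' : epath u v) (q : epath v w) :
  htpy p p' -> htpy (ecat p q) (ecat p' q).
Proof.
move=> h; elim: h q => {u v p p'} /=.
- by move=> *; exact: htpy_refl.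
- by move=> u v p p' _ IH q; exact: htpy_sym.
- by move=> u v p p' p'' _ IH _ IH' q; apply: htpy_trans (IH q) (IH' q).
- by move=> u v t a p p' _ IH q; exact/htpy_fwd/IH.
- by move=> u v t a p p' _ IH q; exact/htpy_bwd/IH.
- by move=> *; exact: htpy_fwdK.
- by move=> *; exact: htpy_bwdK.
- by move=> *; exact: htpy_face.
Qed.

Lemma htpy_cat u v w (p p' : epath u v) (q q' : epath v w) :
  htpy p p' -> htpy q q' -> htpy (ecat p q) (ecat p' q').
Proof.
by move=> pp' qq'; apply: htpy_trans (htpy_catl q pp') (htpy_catr p' qq').
Qed.

Lemma htpy_catpV u v (p : epath u v) : htpy (ecat p (erev p)) (Enil u).
Proof.
elim: p => [?|? ? ? a p IHp|? ? ? a p IHp] /=; first exact: htpy_refl.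
  rewrite ecatA; apply: htpy_trans (htpy_fwdK a (Enil _)).
  by apply/htpy_fwd; apply: htpy_trans (htpy_catl _ IHp) (htpy_refl _).
rewrite ecatA; apply: htpy_trans (htpy_bwdK a (Enil _)).
by apply/htpy_bwd; apply: htpy_trans (htpy_catl _ IHp) (htpy_refl _).
Qed.

Lemma htpy_catVp u v (p : epath u v) : htpy (ecat (erev p) p) (Enil v).
Proof.
elim: p => [?|? ? ? a p IHp|? ? ? a p IHp] /=; first exact: htpy_refl.
  by rewrite -ecatA /=; apply: htpy_trans IHp; apply/htpy_catr/htpy_bwdK.
by rewrite -ecatA /=; apply: htpy_trans IHp; apply/htpy_catr/htpy_fwdK.
Qed.

Lemma htpy_rev u v (p q : epath u v) : htpy p q -> htpy (erev p) (erev q).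
Proof.
move=> pq; apply: htpy_trans (_ : htpy _ (ecat (erev p) (ecat q (erev q)))) _.
  rewrite -{1}[erev p]ecatp0; apply/htpy_catr/htpy_sym/htpy_catpV.
rewrite ecatA; apply: (@htpy_trans _ _ _ (ecat (ecat (erev p) p) (erev q))).
  exact/htpy_catl/htpy_catr/htpy_sym.
exact: htpy_catl _ (htpy_catVp p).
Qed.

End EdgePaths.

Section FundamentalGroup.
Variables (S : sset2) (x : S).

Definition loop := {classic (epath x x)}.

Definition htpyb : rel loop := fun p q => `[< htpy p q >].

Fact htpyb_equiv : equiv_class_of htpyb.
Proof.
split=> [p|p q|q p r]; first exact/asboolP/htpy_refl.
  by apply/asboolP/asboolP; exact: htpy_sym.
by move=> /asboolP pq /asboolP qr; apply/asboolP/(htpy_trans pq qr).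
Qed.

Canonical htpyb_equiv_rel := EquivRelPack htpyb_equiv.
Canonical htpyb_encModRel := defaultEncModRel htpyb.

Definition pi1 := {eq_quot htpyb}.
HB.instance Definition _ : EqQuotient loop htpyb pi1 := EqQuotient.on pi1.
HB.instance Definition _ := Choice.on pi1.

Definition loop_class (p : epath x x) : pi1 := \pi_pi1 (p : loop).

Lemma loop_classP (p q : epath x x) : loop_class p = loop_class q <-> htpy p q.
Proof.
split=> [/eqP|pq]; first by rewrite /loop_class eqmodE => /asboolP.
by apply/eqP; rewrite /loop_class eqmodE; apply/asboolP.
Qed.

Lemma loop_class_surj (c : pi1) : exists p, c = loop_class p.
Proof. by exists (repr c); rewrite /loop_class reprK. Qed.

Lemma htpy_repr (p : epath x x) : htpy (repr (loop_class p) : loop) p.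
Proof. by apply/loop_classP; rewrite {1}/loop_class reprK. Qed.

Definition pi1_one : pi1 := loop_class (Enil x).
Definition pi1_mul (c d : pi1) : pi1 :=
  loop_class (ecat (repr c : loop) (repr d : loop)).
Definition pi1_inv (c : pi1) : pi1 := loop_class (erev (repr c : loop)).

Lemma pi1_mulE p q :
  pi1_mul (loop_class p) (loop_class q) = loop_class (ecat p q).
Proof. by apply/loop_classP/htpy_cat; exact: htpy_repr. Qed.

Lemma pi1_invE p : pi1_inv (loop_class p) = loop_class (erev p).
Proof. by apply/loop_classP/htpy_rev/htpy_repr. Qed.

Fact pi1_mulA : associative pi1_mul.
Proof.
move=> a b c; have [p ->] := loop_class_surj a; have [q ->] := loop_class_surj b.
by have [r ->] := loop_class_surj c; rewrite !pi1_mulE ecatA.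
Qed.

Fact pi1_mul1 : left_id pi1_one pi1_mul.
Proof. by move=> a; have [p ->] := loop_class_surj a; rewrite pi1_mulE. Qed.

Fact pi1_mulr1 : right_id pi1_one pi1_mul.
Proof.
by move=> a; have [p ->] := loop_class_surj a; rewrite pi1_mulE ecatp0.
Qed.

Fact pi1_mulV : left_inverse pi1_one pi1_inv pi1_mul.
Proof.
move=> a; have [p ->] := loop_class_surj a; rewrite pi1_invE pi1_mulE.
exact/loop_classP/htpy_catVp.
Qed.

Fact pi1_mulrV : right_inverse pi1_one pi1_inv pi1_mul.
Proof.
move=> a; have [p ->] := loop_class_surj a; rewrite pi1_invE pi1_mulE.
exact/loop_classP/htpy_catpV.
Qed.

HB.instance Definition _ :=
  isGroup.Build pi1 pi1_mulA pi1_mul1 pi1_mulr1 pi1_mulV pi1_mulrV.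

Lemma loop_class1 : loop_class (Enil x) = 1%g.
Proof. by []. Qed.

Lemma loop_classM p q : loop_class (ecat p q) = (loop_class p * loop_class q)%g.
Proof. by rewrite -pi1_mulE. Qed.

Lemma loop_classV p : loop_class (erev p) = ((loop_class p)^-1)%g.
Proof. by rewrite -pi1_invE. Qed.

End FundamentalGroup.

Record sset2_map (S T : sset2) := Sset2Map {
  vmap :> S -> T;
  emap : forall u v, edge u v -> edge (vmap u) (vmap v);
  map_face : forall u v w (a : edge u v) (b : edge v w) (c : edge u w),
    face a b c -> face (emap a) (emap b) (emap c)
}.

Section FundamentalGroupFunctor.
Variables (S T : sset2) (f : sset2_map S T).

Fixpoint epath_map u v (p : epath u v) : epath (f u) (f v) :=
  match p with
  | Enil u => Enil (f u)
  | Efwd _ _ _ a p => Efwd (emap f a) (epath_map p)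
  | Ebwd _ _ _ a p => Ebwd (emap f a) (epath_map p)
  end.

Lemma epath_map_cat u v w (p : epath u v) (q : epath v w) :
  epath_map (ecat p q) = ecat (epath_map p) (epath_map q).
Proof. by elim: p w q => //= ? ? ? a p IHp w q; rewrite IHp. Qed.

Lemma epath_map_htpy u v (p q : epath u v) :
  htpy p q -> htpy (epath_map p) (epath_map q).
Proof.
elim=> {u v p q} /=; try by move=> *; constructor.
  by move=> u v p q r _ IH _; apply: htpy_trans.
by move=> u v w t a b c p /(map_face f); exact: htpy_face.
Qed.

(* The map induced by [f] on fundamental groups, followed by the change of     *)
(* base point along an edge [e] from [y] to [f x].                             *)
Definition pi1_map (x : S) (y : T) (e : edge y (f x)) (c : pi1 x) : pi1 y :=
  loop_class
    (Efwd e (ecat (epath_map (repr c : loop x)) (Ebwd e (Enil y)))).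

Lemma pi1_mapE (x : S) (y : T) (e : edge y (f x)) (p : epath x x) :
  pi1_map e (loop_class p) =
  loop_class (Efwd e (ecat (epath_map p) (Ebwd e (Enil y)))).
Proof. exact/loop_classP/htpy_fwd/htpy_catl/epath_map_htpy/htpy_repr. Qed.

Fact pi1_map_monoid_morphism (x : S) (y : T) (e : edge y (f x)) :
  monoid.monoid_morphism (pi1_map e).
Proof.
split=> [|c d].
  by rewrite -!loop_class1 pi1_mapE; exact/loop_classP/htpy_fwdK.
have [p ->] := loop_class_surj c; have [q ->] := loop_class_surj d.
rewrite -loop_classM !pi1_mapE -loop_classM.
apply/loop_classP => /=; apply: htpy_fwd.
rewrite epath_map_cat -!ecatA /=; apply: htpy_catr.
exact/htpy_sym/htpy_bwdK.
Qed.

End FundamentalGroupFunctor.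

(******************************************************************************)
(* K_1                                                                        *)
(*                                                                            *)
(* K_1(A) is the fundamental group, at the vertex (0, 0), of the              *)
(* Gillet-Grayson G-construction G.A of A with its split exact structure:     *)
(* G.A is the simplicial loop space of Waldhausen's S.A, its geometric        *)
(* realization is the K-theory space (the loop space of BQA), and             *)
(* K_n(A) = pi_n(G.A, (0, 0)).  An n-simplex of G.A is a pair of              *)
(* (n+1)-simplices of S.A with the same 0-th face, i.e. two filtrations       *)
(* P0 -> ... -> Pn and Q0 -> ... -> Qn together with choices of all           *)
(* subquotients Pj/Pi = Qj/Qi (i < j), which are shared by both filtrations.  *)
(******************************************************************************)

Section GConstruction.
Variable A : addCat.

Record conf (X Y Z : A) := Conf {
  cinf : hom X Y;
  cdef : hom Y Z;
  confP : conflation cinf cdef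
}.

Record Gedge (u v : A * A) := GEdge {
  gquo : A;
  gconf1 : conf u.1 v.1 gquo;
  gconf2 : conf u.2 v.2 gquo
}.

(* A 3-simplex of S.A, on P0 -> P1 -> P2 with subquotients C01, C02, C12.      *)
Definition flag (P0 P1 P2 C01 C02 C12 : A) (a : conf P0 P1 C01)
    (b : conf P1 P2 C12) (c : conf P0 P2 C02) (q : conf C01 C02 C12) : Prop :=
  [/\ cinf c = cinf b \\o cinf a,
      cinf q \\o cdef a = cdef c \\o cinf b
    & cdef b = cdef q \\o cdef c].

Definition Gface (u v w : A * A) (a : Gedge u v) (b : Gedge v w)
    (c : Gedge u w) : Prop :=
  exists q : conf (gquo a) (gquo c) (gquo b),
    flag (gconf1 a) (gconf1 b) (gconf1 c) q /\
    flag (gconf2 a) (gconf2 b) (gconf2 c) q.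

Definition Gcons : sset2 := Sset2 Gface.

Definition K1 : groupType := pi1 ((zob A, zob A) : Gcons).

Fact conflation0 (X : A) : conflation (0 : hom (zob A) X) (idm X).
Proof.
have [h1 h2] := zobP A.
exists (zob A), X, X, 0, (idm X), 0, (idm X), (idm _), (idm _), (idm _).
split; first by split; rewrite ?comp0m ?compm0 ?comp1m ?add0r // h1.
by split; rewrite ?comp1m ?compm1 //; exists (idm _); rewrite comp1m.
Qed.

(* The edge (0, 0) -> (X, X) given by the conflation 0 -> X = X, twice.        *)
Definition Gbase (X : A) : @edge Gcons (zob A, zob A) (X, X) :=
  @GEdge (zob A, zob A) (X, X) X
    (Conf (conflation0 X)) (Conf (conflation0 X)).

End GConstruction.

Section K1Functor.
Variables (A B : addCat) (F : addFunctor A B).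

Definition conf_map (X Y Z : A) (c : conf X Y Z) : conf (F X) (F Y) (F Z) :=
  Conf (fhom_conflation F (confP c)).

Definition Gvmap (u : Gcons A) : Gcons B := (F u.1, F u.2).

Definition Gemap (u v : Gcons A) (a : edge u v) : edge (Gvmap u) (Gvmap v) :=
  @GEdge B (Gvmap u) (Gvmap v) (F (gquo a))
    (conf_map (gconf1 a)) (conf_map (gconf2 a)).

Fact Gmap_face (u v w : Gcons A) (a : edge u v) (b : edge v w) (c : edge u w) :
  face a b c -> face (Gemap a) (Gemap b) (Gemap c).
Proof.
case=> q [[e1 e2 e3] [e4 e5 e6]]; exists (conf_map q).
by split; split; rewrite /= -!fhomM ?e1 ?e2 ?e3 ?e4 ?e5 ?e6.
Qed.

Definition Gmap : sset2_map (Gcons A) (Gcons B) := Sset2Map Gmap_face.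

(* F need not send the chosen zero object of A to that of B, whence the change *)
(* of base point along (0, 0) -> (F 0, F 0).                                   *)
Definition K1_map : K1 A -> K1 B :=
  @pi1_map _ _ Gmap (zob A, zob A) (zob B, zob B) (Gbase (F (zob A))).

HB.instance Definition _ :=
  isUMagmaMorphism.Build (K1 A) (K1 B) K1_map
    (@pi1_map_monoid_morphism _ _ Gmap (zob A, zob A) (zob B, zob B)
       (Gbase (F (zob A)))).

End K1Functor.

(* Main.v *)
From mathcomp Require Import all_boot all_algebra.
From mathcomp Require Import generic_quotient ring_quotient.
From mathcomp Require Import boolp.
From mathcomp.multinomials Require Import freeg.
Require Import Defs.

Set Implicit Arguments.
Unset Strict Implicit.
Unset Printing Implicit Defensive.

Import GRing.Theory.
Local Open Scope ring_scope.
Local Open Scope quotient_scope.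

(** The K_1 part of the sequence is controlled by automorphisms.  An isomorphism
    [t : Q -> P] gives an edge from the base point of the G-construction to the
    vertex (P, Q), and two of them give a loop, [delta].  Along an edge of the
    G-construction an isomorphism extends over the common quotient, and the edges
    of the isomorphisms at both ends bound a 2-simplex.  Hence [delta] does not
    change along edges, the class of an automorphism is multiplicative and is not
    affected by adding an identity or by unipotent automorphisms, and, in a
    category with cancellation, K_1 is generated by the loops [delta]
    ([K1_generated]).

    The Krull-Schmidt hypothesis is used through two consequences only, both
    obtained from local endomorphism rings by elimination and exchange: biproducts
    cancel, and split monomorphisms have complements.  With complements, an
    isomorphism [X -> Y] of the quotient lifts to an isomorphism of [X + C] with
    [Y + D] where [C] and [D] lie in the subcategory ([quot_isom_lift]).  For an
    automorphism, cancellation identifies [C] with [D], so that it lifts to an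
    automorphism; this makes K_1 of the quotient functor surjective.  The quotient
    is again Krull-Schmidt, hence has cancellation as well.

    For exactness at K_1(A), the quotient functor is inverted on K_1(A) modulo the
    image of K_1(B).  Two lifts of the same automorphism differ, after adding
    objects of [B], by some [1 + b a] with [b a] factoring through an object of
    [B], and the matrix identity behind [aut_class_swap] gives [1 + b a] the class
    of the automorphism [1 + a b] of that object ([aut_class_eqmod]).  So each
    automorphism of the quotient has a well-defined class in K_1(A) modulo K_1(B).
    Measuring with it how far the edges of the G-construction of the quotient are
    from preserving chosen isomorphisms at the vertices gives a cocycle
    ([edge_value_face]), whose values on loops invert the quotient functor
    ([path_value_K1_map]).

    In K_0, equality of two classes means isomorphism after adding a common
    object, hence isomorphism by cancellation ([K0_class_eq_iso]).  This gives
    injectivity of K_0(B) -> K_0(A) at once, and exactness at K_0(A) by lifting an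
    isomorphism of the quotient. *)

(** * Isomorphisms and biproducts in preadditive categories *)

Section Preadditive.
Variable A : preaddCat.
Implicit Types X Y Z W L : A.

Definition iso X Y : Prop := exists f : hom X Y, isom f.

Lemma isom_id X : isom (idm X).
Proof. by exists (idm X); rewrite comp1m. Qed.

Lemma isom_comp X Y Z (g : hom Y Z) (f : hom X Y) :
  isom g -> isom f -> isom (g \\o f).
Proof.
move=> [g' [g'g gg']] [f' [f'f ff']]; exists (f' \\o g').
by rewrite -!compA (compA g') g'g comp1m f'f (compA f) ff' comp1m gg'.
Qed.

Lemma isomI X Y Z (f : hom Y Z) (a b : hom X Y) :
  isom f -> f \\o a = f \\o b -> a = b.
Proof.
by move=> [g [gf _]] e; rewrite -(comp1m a) -(comp1m b) -gf -!compA e.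
Qed.

Lemma isomIr X Y Z (f : hom X Y) (a b : hom Y Z) :
  isom f -> a \\o f = b \\o f -> a = b.
Proof.
by move=> [g [_ fg]] e; rewrite -(compm1 a) -(compm1 b) -fg !compA e.
Qed.

Lemma isom_compIr X Y Z (g : hom Y Z) (f : hom X Y) :
  isom (g \\o f) -> isom f -> isom g.
Proof.
move=> igf [f' [f'f ff']].
rewrite -(compm1 g) -ff' compA; apply: isom_comp igf _.
by exists f; split.
Qed.

Lemma isomN X Y (f : hom X Y) : isom (- f) -> isom f.
Proof.
move=> [g [gf fg]]; exists (- g).
by rewrite compNm -compmN gf -fg compmN compNm.
Qed.

Lemma iso_refl X : iso X X.
Proof. by exists (idm X); exact: isom_id. Qed.

Lemma iso_sym X Y : iso X Y -> iso Y X.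
Proof. by move=> [f [g [gf fg]]]; exists g, f. Qed.

Lemma iso_trans X Y Z : iso X Y -> iso Y Z -> iso X Z.
Proof. by move=> [f hf] [g hg]; exists (g \\o f); exact: isom_comp. Qed.

Lemma zero_objectP X : zero_object X <-> idm X = 0.
Proof.
split=> [[h _]|X0]; first exact: h.
by split=> Y f; [rewrite -(comp1m f)|rewrite -(compm1 f)]; rewrite X0 ?comp0m ?compm0.
Qed.

Lemma zero_object_isom X Y (f : hom X Y) :
  zero_object X -> zero_object Y -> isom f.
Proof.
move=> [_ hX] [hY _]; exists 0.
by split; [rewrite [RHS]hX [LHS]hX|rewrite [RHS]hY [LHS]hY].
Qed.

Section Biproduct.
Variables (X Y W : A) (i1 : hom X W) (i2 : hom Y W) (p1 : hom W X) (p2 : hom W Y).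
Hypothesis bp : biproduct i1 i2 p1 p2.

(** Rewrite rules contracting a projection against an injection, also in the
    middle of a right-associated composite. *)
Definition biprodE :
  (p1 \\o i1 = idm X) * (p2 \\o i2 = idm Y) * (p1 \\o i2 = 0) * (p2 \\o i1 = 0) *
  (forall T (f : hom T X), p1 \\o (i1 \\o f) = f) *
  (forall T (f : hom T Y), p2 \\o (i2 \\o f) = f) *
  (forall T (f : hom T Y), p1 \\o (i2 \\o f) = 0) *
  (forall T (f : hom T X), p2 \\o (i1 \\o f) = 0).
Proof.
case: bp => e1 e2 e3 e4 _.
by do !split=> //; move=> T f; rewrite compA ?(e1, e2, e3, e4) ?comp1m ?comp0m.
Qed.

Lemma biprod1 : i1 \\o p1 + i2 \\o p2 = idm W.
Proof. by case: bp. Qed.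

Lemma biprod_epi Z (f g : hom W Z) :
  f \\o i1 = g \\o i1 -> f \\o i2 = g \\o i2 -> f = g.
Proof.
move=> e1 e2; rewrite -(compm1 f) -(compm1 g) -biprod1 !compDr.
by rewrite !(compA f) !(compA g) e1 e2.
Qed.

Lemma biprod_mono Z (f g : hom Z W) :
  p1 \\o f = p1 \\o g -> p2 \\o f = p2 \\o g -> f = g.
Proof.
move=> e1 e2; rewrite -(comp1m f) -(comp1m g) -biprod1 !compDl.
by rewrite -!compA e1 e2.
Qed.

Lemma biproductC : biproduct i2 i1 p2 p1.
Proof. by case: bp => *; split=> //; rewrite addrC. Qed.

Lemma biproduct_transport V (f : hom W V) (g : hom V W) :
  g \\o f = idm W -> f \\o g = idm V ->
  biproduct (f \\o i1) (f \\o i2) (p1 \\o g) (p2 \\o g).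
Proof.
move=> gf fg; have E T (x : hom T W) : g \\o (f \\o x) = x.
  by rewrite compA gf comp1m.
split; rewrite -?compA ?E ?biprodE //.
by rewrite -compDr !compA -compDl biprod1 comp1m.
Qed.

Lemma biproduct_left_iso X' (f : hom X X') (g : hom X' X) :
  g \\o f = idm X -> f \\o g = idm X' -> biproduct (i1 \\o g) i2 (f \\o p1) p2.
Proof.
move=> gf fg; split; rewrite -?compA ?biprodE ?compm0 //.
by rewrite (compA g) gf comp1m biprod1.
Qed.

End Biproduct.

End Preadditive.

(** * Krull-Schmidt categories: cancellation and complements *)

(** The two biproducts share their total object, so that the property passes
    verbatim to full subcategories. *)
Definition cancellative (A : preaddCat) : Prop :=
  forall (X Y Z W : A) (i1 : hom X W) (i2 : hom Z W) (p1 : hom W X)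
    (p2 : hom W Z) (j1 : hom Y W) (j2 : hom Z W) (q1 : hom W Y) (q2 : hom W Z),
    biproduct i1 i2 p1 p2 -> biproduct j1 j2 q1 q2 -> iso X Y.

Definition split_monos_have_complements (A : preaddCat) : Prop :=
  forall (X W : A) (m : hom X W) (r : hom W X), r \\o m = idm X ->
    exists (C : A) (j : hom C W) (r' : hom W X) (q : hom W C),
      biproduct m j r' q.

(** Finite direct sums of objects with local endomorphism rings, in a form that
    supports induction without families indexed by ordinals. *)
Inductive local_sum (A : preaddCat) : A -> Prop :=
| local_sum0 W : zero_object W -> local_sum W
| local_sumS X L W (i1 : hom X W) (i2 : hom L W) (p1 : hom W X) (p2 : hom W L) :
    biproduct i1 i2 p1 p2 -> local_sum X -> local_end L -> local_sum W.

Section LocalEnd.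
Variable A : preaddCat.
Implicit Types X Y Z W L : A.

Lemma local_endD L (f g : hom L L) :
  local_end L -> isom (f + g) -> isom f \/ isom g.
Proof.
move=> [_ h] fg; have [|nf] := pselect (isom f); first by left.
have [|ng] := pselect (isom g); first by right.
by case: (h _ _ nf ng).
Qed.

(** The idempotent attached to a split monomorphism between objects with local
    endomorphism rings is nonzero, hence the identity. *)
Lemma local_end_split L L' (m : hom L L') (r : hom L' L) :
  local_end L -> local_end L' -> isom (r \\o m) -> isom m.
Proof.
move=> lL lL' [u [u1 u2]].
pose e := m \\o (u \\o r).
have ee : e \\o e = e by rewrite /e -!compA (compA r m) (compA u) u1 comp1m.
have em : e \\o m = m by rewrite /e -!compA u1 compm1.
have : isom (e + (idm L' - e)) by rewrite addrC subrK; exact: isom_id.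
case/(local_endD lL') => [ie|ie].
  have e1 : e = idm L' by apply: (isomI ie); rewrite compm1.
  by exists (u \\o r); rewrite -compA.
have e0 : e = 0.
  apply: (isomI ie); rewrite compDl compNm comp1m ee subrr.
  by rewrite compm0.
case: lL => nz _; case: nz; rewrite -u1 -em e0 comp0m compm0.
by rewrite compm0.
Qed.

(** If the component [L -> L] of the identity of [W] is not invertible, it
    becomes so after a transvection of the first biproduct, because [L] has a
    local endomorphism ring; Gaussian elimination then gives the isomorphism of
    the other summands. *)
Lemma local_end_cancel X Y L W (i1 : hom X W) (i2 : hom L W) (p1 : hom W X)
    (p2 : hom W L) (j1 : hom Y W) (j2 : hom L W) (q1 : hom W Y) (q2 : hom W L) :
  local_end L -> biproduct i1 i2 p1 p2 -> biproduct j1 j2 q1 q2 -> iso X Y.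
Proof.
move=> lL bi bj.
have gauss (f g : hom W W) : g \\o f = idm W -> f \\o g = idm W ->
    isom (q2 \\o f \\o i2) -> iso X Y.
  move=> gf fg [e [e1 e2]]; pose h := f \\o i1 - f \\o i2 \\o e \\o q2 \\o f \\o i1.
  have q2h : q2 \\o h = 0.
    by rewrite /h compDr compmN !compA e2 comp1m subrr.
  exists (q1 \\o h), (p1 \\o g \\o j1); split.
    have -> : p1 \\o g \\o j1 \\o (q1 \\o h) = p1 \\o (g \\o h).
      rewrite -!compA (compA j1) (canRL (addrK _) (biprod1 bj)) compDl compNm.
      by rewrite -compA q2h compm0 subr0 comp1m.
    rewrite /h compDr compmN !compA gf !comp1m compDr compmN !compA.
    by rewrite !(biprodE bi) !comp0m subr0.
  have hp : h \\o p1 = f - f \\o i2 \\o e \\o q2 \\o f.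
    have := biprod1 bi; move/(canRL (addrK _)) => E.
    rewrite /h compDl compNm -!compA E !(compDr, compmN) !compm1.
    have -> : f \\o (i2 \\o (e \\o (q2 \\o (f \\o (i2 \\o p2)))))
             = f \\o (i2 \\o (e \\o (q2 \\o f \\o i2) \\o p2)) by rewrite -!compA.
    by rewrite e1 comp1m opprB addrA subrK.
  rewrite -!compA (compA h) hp !(compA _ g) !compDl !compNm -!compA.
  rewrite !(compA f g) fg !comp1m !(biprodE bj) compDr !compmN.
  by rewrite !(biprodE bj) !compm0 subr0.
have [d|d] := pselect (isom (q2 \\o i2)).
  by apply: (gauss (idm W) (idm W)); rewrite ?comp1m ?compm1.
have : isom (q2 \\o i2 \\o (p2 \\o j2) + q2 \\o i1 \\o (p1 \\o j2)).
  rewrite -!compA -compDr !compA -compDl addrC !biprod1 // comp1m.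
  by rewrite (biprodE bj); exact: isom_id.
case/(local_endD lL) => [h|h].
  have hp : isom (p2 \\o j2) by apply: local_end_split h.
  by case: d; apply: isom_compIr h hp.
pose b := p1 \\o j2.
pose f := idm W + i1 \\o b \\o p2; pose g := idm W - i1 \\o b \\o p2.
have bb : i1 \\o b \\o p2 \\o (i1 \\o b \\o p2) = 0.
  by rewrite -!compA !(biprodE bi) !compm0.
apply: (gauss f g).
- by rewrite /f /g compDl compNm !compDr bb !(compm1, comp1m) addr0 addrK.
- by rewrite /f /g compDl !compDr !compmN bb !(compm1, comp1m) oppr0 addr0 subrK.
rewrite /f compDr compDl compm1 -!compA (biprodE bi) compm1.
have : isom (q2 \\o i2 + q2 \\o (i1 \\o b) - q2 \\o i2).
  by rewrite addrC addKr compA.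
by case/(local_endD lL) => [//|/isomN].
Qed.

Lemma local_sum_iso X Y : local_sum X -> iso X Y -> local_sum Y.
Proof.
move=> [W /zero_objectP W0|U L W i1 i2 p1 p2 bp sU lL] [f [g [gf fg]]].
  by apply/local_sum0/zero_objectP; rewrite -fg -(comp1m g) W0 comp0m compm0.
exact: local_sumS (biproduct_transport bp gf fg) sU lL.
Qed.

End LocalEnd.

Section KrullSchmidt.
Variable A : addCat.
Implicit Types X Y Z W L : A.

(** Partial sums over a duplicate-free list of indices, realised as a retract
    of [W]. *)
Lemma krull_schmidt_local_sum W : krull_schmidt A -> local_sum W.
Proof.
move=> /(_ W) [n [X [i [p [[e1 e2 e3] lX]]]]].
suff H (s : seq 'I_n) : uniq s -> exists (V : A) (j : hom V W) (q : hom W V),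
    [/\ q \\o j = idm V, j \\o q = \sum_(k <- s) i k \\o p k & local_sum V].
  have [V [j [q [qj jq sV]]]] := H _ (enum_uniq 'I_n).
  by apply: local_sum_iso sV _; exists j, q; rewrite jq big_enum.
elim: s => [_|k s IH] /=.
  exists (zob A), 0, 0; rewrite big_nil; split; last 1 first.
  - exact: local_sum0 (zobP A).
  - by rewrite [RHS](proj1 (zobP A)) comp0m.
  - by rewrite comp0m.
move=> /andP[ks us]; have [V [j [q [qj jq sV]]]] := IH us.
have [V' [u1 [u2 [v1 [v2 bp]]]]] := biproductP V (X k).
have jqi : j \\o q \\o i k = 0.
  rewrite jq; elim: s ks {IH us jq} => [|l s IH]; first by rewrite big_nil comp0m.
  rewrite inE negb_or big_cons compDl -compA => /andP[kl /IH ->].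
  by rewrite e2 1?eq_sym // compm0 addr0.
have jqp : p k \\o (j \\o q) = 0.
  rewrite jq; elim: s ks {IH us jq jqi} => [|l s IH]; first by rewrite big_nil compm0.
  rewrite inE negb_or big_cons compDr compA => /andP[kl /IH ->].
  by rewrite e2 // comp0m addr0.
have qi : q \\o i k = 0 by rewrite -(comp1m q) -qj -!compA (compA j) jqi compm0.
have pj : p k \\o j = 0 by rewrite -(compm1 j) -qj !compA -(compA (p k)) jqp comp0m.
exists V', (j \\o v1 + i k \\o v2), (u1 \\o q + u2 \\o p k); split.
- rewrite !(compDl, compDr) -!compA !(compA q, compA (p k)) qj qi pj e1.
  by rewrite !(comp0m, comp1m, compm0) addr0 add0r biprod1.
- rewrite !(compDl, compDr) -!compA !(biprodE bp) !compm0 addr0 add0r.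
  by rewrite jq big_cons addrC.
- exact: local_sumS bp sV (lX k).
Qed.

(** Reassociating [X + (Z' + L)] as [(X + Z') + L] allows one local summand of
    [Z] to be cancelled at a time. *)
Lemma local_sums_cancellative :
  (forall W, local_sum W) -> cancellative A.
Proof.
move=> lA X Y Z; move: (lA Z) => sZ.
elim: sZ X Y => {Z} [Z Z0|Z' L Z a1 a2 b1 b2 ab _ IH lL] X Y
    W i1 i2 p1 p2 j1 j2 q1 q2 bi bj.
  have [hX hY] := Z0.
  exists (q1 \\o i1), (p1 \\o j1); split.
    rewrite -compA (compA j1); have := biprod1 bj.
    by rewrite (hX _ q2) compm0 addr0 => ->; rewrite comp1m (biprodE bi).
  rewrite -compA (compA i1); have := biprod1 bi.
  by rewrite (hX _ p2) compm0 addr0 => ->; rewrite comp1m (biprodE bj).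
have assoc V k1 k2 r1 r2 (bk : @biproduct A V Z W k1 k2 r1 r2) :
    exists (U : A) u1 u2 v1 v2 (w1 : hom U W) w2 t1 t2,
    @biproduct A V Z' U u1 u2 v1 v2 /\ @biproduct A U L W w1 w2 t1 t2.
  have [U [u1 [u2 [v1 [v2 uv]]]]] := biproductP V Z'.
  exists U, u1, u2, v1, v2, (k1 \\o v1 + k2 \\o (a1 \\o v2)), (k2 \\o a2),
    (u1 \\o r1 + u2 \\o (b1 \\o r2)), (b2 \\o r2); split=> //.
  split.
  - rewrite !(compDl, compDr) -!compA !(biprodE bk) !(biprodE ab).
    by rewrite !compm0 addr0 add0r biprod1.
  - by rewrite -!compA (biprodE bk) (biprodE ab).
  - by rewrite compDl -!compA !(biprodE bk) (biprodE ab) !compm0 addr0.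
  - by rewrite compDr -!compA !(biprodE bk) (biprodE ab) !compm0 addr0.
  - rewrite !(compDl, compDr) -!compA !(biprodE uv) !compm0 addr0 add0r.
    rewrite -addrA -compDr !(compA _ _ r2) -compDl biprod1 // comp1m.
    by rewrite biprod1.
have [U [u1 [u2 [v1 [v2 [w1 [w2 [t1 [t2 [bU bUW]]]]]]]]]] := assoc _ _ _ _ _ bi.
have [U' [u1' [u2' [v1' [v2' [w1' [w2' [t1' [t2' [bU' bUW']]]]]]]]]] :=
  assoc _ _ _ _ _ bj.
have [f [g [gf fg]]] := local_end_cancel lL bUW bUW'.
exact: IH (biproduct_transport bU gf fg) bU'.
Qed.

(** The identity of [L] is a sum of composites through the summands of [W], one
    of which is invertible: [L] is then isomorphic to a local summand of [W], for
    which it can be exchanged. *)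
Lemma local_end_complement L W (m : hom L W) (r : hom W L) :
  local_end L -> local_sum W -> r \\o m = idm L ->
  exists (C : A) (j : hom C W) (r' : hom W L) (q : hom W C),
    biproduct m j r' q /\ local_sum C.
Proof.
move=> lL sW; elim: sW m r => {W} [W W0|W' L' W i1 i2 p1 p2 bp sW' IH lL'] m r rm.
  by case: lL => nz _; case: nz; rewrite -rm (proj1 W0 _ m) compm0.
have : isom (r \\o i1 \\o (p1 \\o m) + r \\o i2 \\o (p2 \\o m)).
  rewrite -!compA -compDr !compA -compDl biprod1 // comp1m rm; exact: isom_id.
case/(local_endD lL) => [[u [u1 _]]|ir]; last first.
  have [n [nm mn]] := local_end_split lL lL' ir.
  exists W', i1, (n \\o p2), (p1 - p1 \\o m \\o n \\o p2); split=> //; split.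
  - by rewrite -compA nm.
  - by rewrite compDl compNm -!compA !(biprodE bp) !compm0 subr0.
  - by rewrite -compA !(biprodE bp) compm0.
  - by rewrite compDl compNm -!compA nm compm1 subrr.
  apply: (biprod_mono bp); rewrite compm1 !(compDr, compmN) !compA !(biprodE bp).
    by rewrite !comp1m addrC subrK.
  by rewrite !comp0m subr0 addr0 mn comp1m.
have rm1 : u \\o (r \\o i1) \\o (p1 \\o m) = idm L by rewrite -compA.
have [C' [j [r' [q [bC sC']]]]] := IH _ _ rm1.
have [C [a1 [a2 [b1 [b2 bb]]]]] := biproductP C' L'.
exists C, (i1 \\o j \\o b1 + i2 \\o b2), (r' \\o p1),
  (a1 \\o q \\o p1 + a2 \\o (p2 - p2 \\o m \\o r' \\o p1)).
split; last exact: local_sumS bb sC' lL'.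
have r'm : r' \\o (p1 \\o m) = idm L by rewrite (biprodE bC).
have qm : q \\o (p1 \\o m) = 0 by rewrite (biprodE bC).
split.
- by rewrite -compA.
- rewrite !(compDl, compDr, compNm, compmN) -!compA !(biprodE bp) !(biprodE bC).
  by rewrite !(compm0, addr0, oppr0, add0r) biprod1.
- by rewrite !compDr -!compA !(biprodE bp) !(biprodE bC) compm0 addr0.
- rewrite !(compDl, compDr, compNm, compmN) -!compA r'm qm.
  by rewrite !compm0 compm1 subrr addr0.
apply: (biprod_mono bp); rewrite compm1 !(compDr, compDl, compmN) -!compA.
  rewrite !(biprodE bp) !(biprodE bb) !(compm0, subr0, addr0).
  by rewrite !compA -compDl biprod1 // comp1m.
rewrite !(biprodE bp) !(biprodE bb) !(subr0, addr0, add0r).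
by rewrite addrC subrK.
Qed.

(** For [X = X' + L], a complement [C] of [L] in [W] receives [X'] as a split
    subobject, to which the induction applies. *)
Lemma local_sums_split_monos :
  (forall W, local_sum W) -> split_monos_have_complements A.
Proof.
move=> lA X W m r rm; move: (lA X) (lA W) => sX.
elim: sX W m r rm => {X} [X X0|X' L X a1 a2 b1 b2 ab _ IH lL] W m r rm sW.
  have [h1 h2] := X0; exists W, (idm W), 0, (idm W).
  by split; rewrite ?comp1m ?compm0 ?add0r // [LHS]h2 ?[RHS]h2.
have rm2 : b2 \\o r \\o (m \\o a2) = idm L.
  by rewrite -compA (compA r) rm comp1m (biprodE ab).
have [C [j [r2 [q [bC sC]]]]] := local_end_complement lL sW rm2.
have rm1 : b1 \\o r \\o j \\o (q \\o (m \\o a1)) = idm X'.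
  have /(canRL (addrK _)) E : j \\o q + m \\o a2 \\o r2 = idm W.
    by rewrite addrC biprod1.
  rewrite -!compA (compA j) E compDl compNm comp1m !compDr !compmN.
  rewrite -!compA !(compA r m) !rm !comp1m !(biprodE ab).
  by rewrite subr0.
have [C' [j' [r' [q' bC']]]] := IH _ _ _ rm1 sC.
exists C', (j \\o j'), (a1 \\o r' \\o q + a2 \\o (r2 - r2 \\o m \\o a1 \\o r' \\o q)),
  (q' \\o q).
have qm2 : q \\o (m \\o a2) = 0 by rewrite (biprodE bC).
have r2m : r2 \\o (m \\o a2) = idm L by rewrite (biprodE bC).
have r'm : r' \\o (q \\o (m \\o a1)) = idm X' by rewrite (biprodE bC').
have q'm : q' \\o (q \\o (m \\o a1)) = 0 by rewrite (biprodE bC').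
split.
- apply: (biprod_epi ab); rewrite comp1m !(compDl, compDr, compNm, compmN) -!compA.
    by rewrite r'm !compm1 subrr addr0.
  by rewrite qm2 r2m !compm0 add0r subr0 compm1.
- by rewrite -!compA !(biprodE bC) !(biprodE bC').
- rewrite !(compDl, compDr, compNm, compmN) -!compA !(biprodE bC) !(biprodE bC').
  by rewrite !(compm0, oppr0, addr0).
- apply: (biprod_epi ab); rewrite comp0m -!compA ?q'm // qm2.
  by rewrite compm0.
have r2mE T (f : hom T L) : r2 \\o (m \\o (a2 \\o f)) = f.
  by rewrite (compA m) compA r2m comp1m.
have qmE T (f : hom T L) : q \\o (m \\o (a2 \\o f)) = 0.
  by rewrite (compA m) compA qm2 comp0m.
apply: (biprod_mono bC); rewrite compm1 !(compDr, compmN) -!compA.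
  rewrite !(biprodE bC) !r2mE addr0.
  by rewrite addrC subrK.
rewrite !(biprodE bC) !qmE subr0 addr0.
rewrite (compA m) !(compA q) !compA -compDl.
by have := biprod1 bC'; rewrite !compA => ->; rewrite comp1m.
Qed.

End KrullSchmidt.

(** * Loops of automorphisms in the G-construction *)

Section Conflations.
Variable A : addCat.
Implicit Types X Y Z W P Q : A.

Lemma conflationP X Y Z (i : hom X Y) (p : hom Y Z) :
  conflation i p <-> exists (j : hom Z Y) (r : hom Y X), biproduct i j r p.
Proof.
split=> [|[j [r bp]]]; last first.
  exists X, Z, Y, i, j, r, p, (idm _), (idm _), (idm _).
  by split=> //; split; rewrite ?comp1m ?compm1 //; exact: isom_id.
move=> [A1 [A2 [W [i1 [i2 [p1 [p2 [a [b [c [bp]]]]]]]]]]].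
move=> [[a' [a1 a2]] [b' [b1 b2]] [c' [c1 c2]] ei ep].
have bq := biproduct_left_iso (biproduct_transport bp b2 b1) a2 a1.
have := biproductC (biproduct_left_iso (biproductC bq) c2 c1); move: bq => _.
rewrite -!compA -ei -ep !compA b1 c1 !comp1m => bq.
by exists (b' \\o i2 \\o c), (a' \\o p1 \\o b); rewrite -!compA in bq *.
Qed.

Lemma biproduct_conflation X Y Z (i : hom X Y) (j : hom Z Y) (r : hom Y X)
  (p : hom Y Z) : biproduct i j r p -> conflation i p.
Proof. by move=> bp; apply/conflationP; exists j, r. Qed.

Lemma isom_deflation X Y (f : hom X Y) :
  isom f -> conflation (0 : hom (zob A) X) f.
Proof.
move=> [g [gf fg]]; apply/conflationP; exists g, 0.
split; rewrite ?comp0m ?compm0 ?add0r //.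
by rewrite [RHS](proj1 (zobP A)).
Qed.

Lemma isom_inflation X Y (f : hom X Y) :
  isom f -> conflation f (0 : hom Y (zob A)).
Proof.
move=> [g [gf fg]]; apply/conflationP; exists 0, g.
split; rewrite ?comp0m ?compm0 ?addr0 //.
by rewrite [RHS](proj1 (zobP A)).
Qed.

Lemma isom_unipotent X Y Z (i : hom X Y) (j : hom Z Y) (r : hom Y X)
  (p : hom Y Z) (x : hom Z X) :
  biproduct i j r p -> isom (idm Y + i \\o x \\o p).
Proof.
move=> bp; exists (idm Y - i \\o x \\o p).
have xx : i \\o x \\o p \\o (i \\o x \\o p) = 0.
  by rewrite -!compA (biprodE bp) !compm0.
rewrite !(compDl, compDr, compNm, compmN) xx !(compm1, comp1m).
by rewrite oppr0 !addr0 subrK addrK.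
Qed.

End Conflations.

Section Loops.
Variable A : addCat.
Implicit Types X Y Z W P Q : A.

Definition Gzero : Gcons A := (zob A, zob A).

(** The isomorphism [t] presents both [P] and [Q] as extensions of [P] by 0. *)
Definition iso_edge P Q (t : hom Q P) (ht : isom t) :
    @edge (Gcons A) Gzero (P, Q) :=
  @GEdge A Gzero (P, Q) P (Conf (isom_deflation (isom_id P)))
    (Conf (isom_deflation ht)).

(** [t'] is a morphism of extensions from the second conflation of [c] to the
    first one which is [t] on the subobjects and the identity on the common
    quotient. *)
Definition compatible (u v : A * A) (c : Gedge u v) (t : hom u.2 u.1)
    (t' : hom v.2 v.1) : Prop :=
  t' \\o cinf (gconf2 c) = cinf (gconf1 c) \\o t /\
  cdef (gconf1 c) \\o t' = cdef (gconf2 c).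

Lemma compatible_exists (u v : A * A) (c : Gedge u v) (t : hom u.2 u.1) :
  isom t -> exists t', isom t' /\ compatible c t t'.
Proof.
case: c => C [i1 p1 c1] [i2 p2 c2] [s [st ts]].
have [j1 [r1 b1]] := proj1 (conflationP _ _) c1.
have [j2 [r2 b2]] := proj1 (conflationP _ _) c2.
exists (i1 \\o t \\o r2 + j1 \\o p2); split; last first.
  split=> /=; rewrite !(compDl, compDr) -!compA !(biprodE b1, biprodE b2).
    by rewrite compm1 compm0 addr0.
  by rewrite add0r.
exists (i2 \\o s \\o r1 + j2 \\o p1); split.
  rewrite !(compDl, compDr) -!compA !(biprodE b1) !compm0 addr0 add0r.
  by rewrite (compA s) st comp1m biprod1.
rewrite !(compDl, compDr) -!compA !(biprodE b2) !compm0 addr0 add0r.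
by rewrite (compA t) ts comp1m biprod1.
Qed.

(** These 2-simplices suffice to rewrite every loop: the filtrations are
    [0 -> P -> P'] and [0 -> Q -> Q'], with subquotients [P], [P'] and the
    quotient of [c]. *)
Lemma compatible_face P Q P' Q' (c : Gedge (P, Q) (P', Q')) (t : hom Q P)
    (t' : hom Q' P') (ht : isom t) (ht' : isom t') :
  compatible c t t' -> @face (Gcons A) _ _ _ (iso_edge ht) c (iso_edge ht').
Proof.
move=> [e1 e2]; exists (gconf1 c).
by split; split; rewrite /= ?compm0 ?comp1m ?compm1.
Qed.

Lemma iso_edge_compatible P Q (t0 : hom (Gzero.2) (Gzero.1)) (t : hom Q P)
    (ht : isom t) : @compatible Gzero (P, Q) (iso_edge ht) t0 t.
Proof. by split; rewrite /= ?compm0 ?comp0m ?comp1m. Qed.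

(** Compatibility along the edge [b] fixes the lift of [t1] up to transvections;
    a suitable transvection makes it compatible along [c] as well. *)
Lemma face_compatible (u v w : Gcons A) (a : edge u v) (b : edge v w)
    (c : edge u w) (t0 : hom u.2 u.1) (t1 : hom v.2 v.1) :
  face a b c -> isom t1 -> compatible a t0 t1 ->
  exists t2, [/\ isom t2, compatible b t1 t2 & compatible c t0 t2].
Proof.
move=> [q [[f1 f2 f3] [g1 g2 g3]]] h1 [ca1 ca2].
have [t [ht [cb1 cb2]]] := compatible_exists b h1.
have [ja [ra bpa]] := proj1 (conflationP _ _) (confP (gconf1 a)).
have [jb [rb bpb]] := proj1 (conflationP _ _) (confP (gconf1 b)).
have [jb' [rb' bpb']] := proj1 (conflationP _ _) (confP (gconf2 b)).
have [jq [rq bpq]] := proj1 (conflationP _ _) (confP q).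
pose d := cdef (gconf1 c) \\o t - cdef (gconf2 c).
have d1 : d = d \\o jb' \\o cdef (gconf2 b).
  apply: (biprod_epi bpb'); rewrite -!compA !(biprodE bpb') ?compm1 // !compm0.
  rewrite /d compDl compNm -compA cb1 (compA (cdef _)) -f2 -g2 -!compA ca2.
  exact: subrr.
have d2 : d = cinf q \\o (rq \\o d).
  apply: (biprod_mono bpq); rewrite !(biprodE bpq) //.
  by rewrite /d compDr compmN compA -f3 -g3 cb2 subrr.
pose z := ja \\o (rq \\o (d \\o jb')).
pose t2 := t - cinf (gconf1 b) \\o z \\o cdef (gconf2 b).
have t2i : t2 \\o cinf (gconf2 b) = cinf (gconf1 b) \\o t1.
  by rewrite compDl compNm -!compA (biprodE bpb') !compm0 subr0.
exists t2; split.
- have -> : t2 = (idm w.1 + cinf (gconf1 b) \\o (- z) \\o cdef (gconf1 b)) \\o t.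
    by rewrite /t2 compDl comp1m !(compmN, compNm) -!compA cb2.
  by apply: isom_comp => //; exact: isom_unipotent bpb.
- split=> //.
  by rewrite compDr compmN -!compA (biprodE bpb) subr0.
split; first by rewrite f1 g1 compA t2i -!compA ca1.
have dz : cdef (gconf1 c) \\o (cinf (gconf1 b) \\o z \\o cdef (gconf2 b)) = d.
  rewrite !compA -f2 -!compA !(biprodE bpa).
  by rewrite (compA d) -d1 -d2.
by rewrite compDr compmN dz opprB addrC subrK.
Qed.

Lemma iso_edge_comp P Q P' Q' (c : @edge (Gcons A) (P, Q) (P', Q'))
    (t : hom Q P) (t' : hom Q' P') (ht : isom t) (ht' : isom t') v
    (p : @epath (Gcons A) (P', Q') v) :
  compatible c t t' -> htpy (Efwd (iso_edge ht) (Efwd c p)) (Efwd (iso_edge ht') p).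
Proof. by move=> /(compatible_face ht ht') /htpy_face. Qed.

(** The edge is homotopic to its own square. *)
Lemma iso_edge_zero (t : hom (zob A) (zob A)) (ht : isom t) v
    (p : epath Gzero v) : htpy (Efwd (iso_edge ht) p) p.
Proof.
have h : htpy (Efwd (iso_edge ht) (Efwd (iso_edge ht) p)) (Efwd (iso_edge ht) p).
  by apply: iso_edge_comp; exact: iso_edge_compatible.
have := htpy_bwd (iso_edge ht) h => {}h.
by apply: htpy_trans (htpy_bwdK _ _); apply: htpy_trans h; exact/htpy_sym/htpy_bwdK.
Qed.

(** Taking the value 1 when [t1] or [t2] is not invertible keeps proofs of
    invertibility out of the arguments, so that [delta] can be rewritten in. *)
Definition delta P Q (t1 t2 : hom Q P) : K1 A :=
  match pselect (isom t1 /\ isom t2) with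
  | left h =>
    loop_class (Efwd (iso_edge (proj1 h)) (Ebwd (iso_edge (proj2 h)) (Enil Gzero)))
  | right _ => 1%g
  end.

Lemma deltaE P Q (t1 t2 : hom Q P) (h1 : isom t1) (h2 : isom t2) :
  delta t1 t2 =
  loop_class (Efwd (iso_edge h1) (Ebwd (iso_edge h2) (Enil Gzero))).
Proof.
rewrite /delta; case: pselect => [h|[]]; last by split.
by rewrite (Prop_irrelevance h1 (proj1 h)) (Prop_irrelevance h2 (proj2 h)).
Qed.

Lemma delta_refl P Q (t : hom Q P) : delta t t = 1%g.
Proof.
have [h|h] := pselect (isom t); last by rewrite /delta; case: pselect => [[]|].
by rewrite (deltaE h h) -loop_class1; exact/loop_classP/htpy_fwdK.
Qed.

Lemma delta_trans P Q (t1 t2 t3 : hom Q P) :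
  isom t1 -> isom t2 -> isom t3 ->
  (delta t1 t2 * delta t2 t3)%g = delta t1 t3.
Proof.
move=> h1 h2 h3; rewrite (deltaE h1 h2) (deltaE h2 h3) (deltaE h1 h3).
rewrite -loop_classM; apply/loop_classP => /=.
exact/htpy_fwd/htpy_bwdK.
Qed.

Lemma delta_compatible P Q P' Q' (c : Gedge (P, Q) (P', Q')) (t1 t2 : hom Q P)
    (t1' t2' : hom Q' P') :
  isom t1 -> isom t2 -> isom t1' -> isom t2' ->
  compatible c t1 t1' -> compatible c t2 t2' -> delta t1' t2' = delta t1 t2.
Proof.
move=> h1 h2 h1' h2' c1 c2; rewrite (deltaE h1 h2) (deltaE h1' h2').
apply/loop_classP.
apply: htpy_trans (htpy_sym (iso_edge_comp h1 h1' _ c1)) _; apply: htpy_fwd.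
apply: htpy_trans (htpy_sym (htpy_bwdK (iso_edge h2) _)) _; apply: htpy_bwd.
exact: htpy_trans (iso_edge_comp h2 h2' _ c2) (htpy_fwdK _ _).
Qed.

End Loops.

Section AutomorphismClasses.
Variable A : addCat.
Implicit Types X Y Z W P Q : A.

Lemma delta_iso P Q P' Q' (f : hom P P') (g : hom Q Q') (t1 t2 : hom Q P)
    (t1' t2' : hom Q' P') :
  isom f -> isom g -> isom t1 -> isom t2 -> isom t1' -> isom t2' ->
  t1' \\o g = f \\o t1 -> t2' \\o g = f \\o t2 -> delta t1' t2' = delta t1 t2.
Proof.
move=> hf hg h1 h2 h1' h2' e1 e2.
pose c : Gedge (P, Q) (P', Q') := @GEdge A (P, Q) (P', Q') _
  (Conf (isom_inflation hf)) (Conf (isom_inflation hg)).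
have z0 (x y : hom Q' (zob A)) : x = y.
  by rewrite (proj1 (zobP A) _ x) [RHS](proj1 (zobP A)).
by apply: (delta_compatible (c := c)) => //; split=> //=; exact: z0.
Qed.

Definition aut_class X (f : hom X X) : K1 A := delta (idm X) f.

Lemma delta_aut_class P Q (t1 t2 : hom Q P) (f : hom P P) :
  isom t1 -> isom t2 -> f \\o t1 = t2 -> delta t1 t2 = aut_class f.
Proof.
move=> h1 h2 e; apply/esym.
have hf : isom f by apply: (isom_compIr (f := t1)); rewrite ?e.
apply: (delta_iso (f := idm P) (g := t1)) => //; try exact: isom_id.
by rewrite comp1m.
Qed.

Lemma aut_class1 X : aut_class (idm X) = 1%g.
Proof. exact: delta_refl. Qed.

(** Composing all isomorphisms [Q -> P] with a fixed automorphism of [P] does not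
    change the loops between them. *)
Lemma aut_classM X (f g : hom X X) :
  isom f -> isom g -> aut_class (f \\o g) = (aut_class f * aut_class g)%g.
Proof.
move=> hf hg; have h1 := isom_id X; have hfg := isom_comp hf hg.
rewrite /aut_class -(delta_trans h1 hf hfg); congr (_ * _)%g.
by apply: (delta_iso (f := f) (g := idm X)); rewrite ?compm1.
Qed.

(** The automorphism [f'] may be [f] plus an identity, up to a unipotent
    automorphism, or a unipotent automorphism when [f] is the identity. *)
Lemma aut_class_compatible X Y Z (i : hom X Y) (j : hom Z Y) (r : hom Y X)
    (p : hom Y Z) (f : hom X X) (f' : hom Y Y) :
  biproduct i j r p -> isom f -> isom f' -> f' \\o i = i \\o f ->
  p \\o f' = p -> aut_class f' = aut_class f.
Proof.
move=> bp hf hf' e1 e2; have h := biproduct_conflation bp.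
pose c := @GEdge A (X, X) (Y, Y) _ (Conf h) (Conf h).
apply: (delta_compatible (c := c)) => //; try exact: isom_id.
by split; rewrite /= ?compm1 ?comp1m.
Qed.

Lemma aut_class_unipotent X Y Z (i : hom X Y) (j : hom Z Y) (r : hom Y X)
    (p : hom Y Z) (x : hom Z X) :
  biproduct i j r p -> aut_class (idm Y + i \\o x \\o p) = 1%g.
Proof.
move=> bp; rewrite -(aut_class1 X).
apply: (aut_class_compatible bp (isom_id X) (isom_unipotent x bp)).
  by rewrite compDl -!compA !(biprodE bp) !compm0 addr0 comp1m compm1.
by rewrite compDr -!compA !(biprodE bp) compm1 addr0.
Qed.

Lemma aut_class_extend X Y Z (i : hom X Y) (j : hom Z Y) (r : hom Y X)
    (p : hom Y Z) (f : hom X X) :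
  biproduct i j r p -> isom f ->
  exists f' : hom Y Y,
    [/\ isom f', aut_class f' = aut_class f, f' \\o i = i \\o f, f' \\o j = j
      & f' = i \\o f \\o r + j \\o p].
Proof.
move=> bp hf; pose f' := i \\o f \\o r + j \\o p.
have hf' : isom f'.
  case: hf => [g [gf fg]]; exists (i \\o g \\o r + j \\o p).
  rewrite !(compDl, compDr) -!compA !(biprodE bp) !compm0 !addr0 !add0r.
  by rewrite (compA g) gf (compA f) fg !comp1m !(biprod1 bp).
have e1 : f' \\o i = i \\o f.
  by rewrite compDl -!compA !(biprodE bp) compm0 compm1 addr0.
exists f'; split=> //; last by rewrite compDl -!compA !(biprodE bp) !compm0 compm1 add0r.
apply: (aut_class_compatible bp) => //.
by rewrite compDr -!compA !(biprodE bp) add0r.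
Qed.

(** On [X + Y] the two automorphisms are extended to commuting ones. *)
Lemma aut_class_comm X Y (f : hom X X) (g : hom Y Y) :
  isom f -> isom g ->
  (aut_class f * aut_class g = aut_class g * aut_class f)%g.
Proof.
move=> hf hg; have [W [i [j [r [p bp]]]]] := biproductP X Y.
have [f' [hf' <- fi fj _]] := aut_class_extend bp hf.
have [g' [hg' <- gj gi _]] := aut_class_extend (biproductC bp) hg.
rewrite -!aut_classM //; congr aut_class; apply: (biprod_epi bp).
  by rewrite -!compA fi gi fi !compA gi.
by rewrite -!compA gj fj gj !compA fj.
Qed.

(** The matrix [m] with rows (1, -b) and (a, 1) is reduced by transvections both
    to diag (1 + ba, 1) and to diag (1, 1 + ab). *)
Lemma aut_class_swap X Z (a : hom X Z) (b : hom Z X) :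
  isom (idm X + b \\o a) ->
  isom (idm Z + a \\o b) /\
  aut_class (idm X + b \\o a) = aut_class (idm Z + a \\o b).
Proof.
set u := _ + _; set v := _ + _ => hu.
have hv : isom v.
  (* the inverse of 1 + ab is 1 - a (1 + ba)^-1 b *)
  case: hu => [w [wu uw]]; exists (idm Z - a \\o w \\o b).
  have wba : w \\o b \\o a = idm X - w by rewrite -wu compDr compm1 addrAC compA subrr add0r.
  have baw : b \\o a \\o w = idm X - w by rewrite -uw compDl comp1m addrAC subrr add0r.
  split.
    rewrite /v compDl compDr compNm compm1 comp1m compDr compm1.
    have -> : a \\o w \\o b \\o (a \\o b) = a \\o b - a \\o w \\o b.
      transitivity (a \\o (w \\o b \\o a) \\o b); first by rewrite !compA.
      by rewrite wba compDr compmN compm1 compDl compNm.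
    by rewrite [a \\o w \\o b + _]addrC subrK addrK.
  rewrite /v compDl compDr comp1m compmN compDr compm1 compmN.
  have -> : a \\o b \\o (a \\o w \\o b) = a \\o b - a \\o w \\o b.
    transitivity (a \\o (b \\o a \\o w) \\o b); first by rewrite !compA.
    by rewrite baw compDr compmN compm1 compDl compNm.
  by rewrite comp1m opprB [a \\o b + _]addrC subrK subrK.
split=> //.
have [W [i [j [r [p bp]]]]] := biproductP X Z; have bq := biproductC bp.
have [u' [hu' <- ui uj _]] := aut_class_extend bp hu.
have [v' [hv' <- vj vi _]] := aut_class_extend bq hv.
pose m := idm W - i \\o b \\o p + j \\o a \\o r.
pose x (c : hom Z X) := idm W + i \\o c \\o p.
pose y (c : hom X Z) := idm W + j \\o c \\o r.
have hx c : isom (x c) := isom_unipotent c bp.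
have hy c : isom (y c) := isom_unipotent c bq.
have xi c : x c \\o i = i by rewrite compDl -!compA !(biprodE bp) !compm0 addr0 comp1m.
have xj c : x c \\o j = j + i \\o c by rewrite compDl -!compA !(biprodE bp) compm1 comp1m.
have yj c : y c \\o j = j by rewrite compDl -!compA !(biprodE bp) !compm0 addr0 comp1m.
have yi c : y c \\o i = i + j \\o c by rewrite compDl -!compA !(biprodE bp) compm1 comp1m.
have mi : m \\o i = i + j \\o a.
  rewrite !compDl compNm -!compA !(biprodE bp) !compm0 comp1m compm1.
  by rewrite subr0.
have mj : m \\o j = j - i \\o b.
  rewrite !compDl compNm -!compA !(biprodE bp) !compm0 comp1m compm1.
  by rewrite addr0.
have e1 : u' \\o y a = x b \\o m.
  apply: (biprod_epi bp); rewrite -!compA.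
    rewrite yi mi !compDr !compA ui uj xi xj compDl.
    by rewrite /u compDr compm1 -addrA !compA [_ + j \\o a]addrC.
  by rewrite yj mj uj compDr compmN !compA xi xj addrK.
have e2 : v' \\o x (- b) = y (- a) \\o m.
  apply: (biprod_epi bp); rewrite -!compA.
    by rewrite xi mi vi compDr !compA yi yj compmN subrK.
  rewrite xj mj !compDr !compmN !compA vi vj yi yj compmN compDl compNm opprB.
  by rewrite /v compDr compm1 !compA -addrA.
have hm : isom m.
  have [k [k1 k2]] := hx b.
  have -> : m = k \\o (u' \\o y a) by rewrite e1 compA k1 comp1m.
  by apply: isom_comp; [exists (x b)|exact: isom_comp].
have ax c : aut_class (x c) = 1%g := aut_class_unipotent c bp.
have ay c : aut_class (y c) = 1%g := aut_class_unipotent c bq.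
transitivity (aut_class m).
  have := congr1 (@aut_class W) e1; rewrite !aut_classM // ax ay.
  by rewrite mulg1 mul1g.
have := congr1 (@aut_class W) e2; rewrite !aut_classM // ax ay.
by rewrite mulg1 mul1g.
Qed.

(** The edge [iso_edge] with a variable vertex as target. *)
Definition vertex_edge (u : Gcons A) :
    forall t : hom u.2 u.1, isom t -> edge (Gzero A) u :=
  let '(P, Q) := u in @iso_edge A P Q.

(** Following a path edge by edge and comparing the isomorphisms at its
    vertices; cancellation provides them when an edge is traversed backwards. *)
Lemma K1_generated (M : K1 A -> Prop) :
  cancellative A -> (forall x y, M x -> M y -> M (x * y)%g) ->
  (forall P Q (t1 t2 : hom Q P), isom t1 -> isom t2 -> M (delta t1 t2)) ->
  forall x, M x.
Proof.
move=> cA MM Md x.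
have H (u v : Gcons A) (p : epath u v) : forall (t : hom u.2 u.1)
    (t' : hom v.2 v.1) (ht : isom t) (ht' : isom t'),
    M (loop_class (Efwd (vertex_edge ht) (ecat p
      (Ebwd (vertex_edge ht') (Enil (Gzero A)))))).
  elim: p => {u v} [[P Q]|[P Q] [P' Q'] [P'' Q''] c p IH|
                         [P Q] [P' Q'] [P'' Q''] c p IH] t t' ht ht' /=.
  - by rewrite -deltaE; exact: Md.
  - have [s [hs cs]] := compatible_exists c ht.
    have /loop_classP -> := iso_edge_comp ht hs
      (ecat p (Ebwd (iso_edge ht') (Enil (Gzero A)))) cs.
    exact: IH.
  have [j1 [r1 b1]] := proj1 (conflationP _ _) (confP (gconf1 c)).
  have [j2 [r2 b2]] := proj1 (conflationP _ _) (confP (gconf2 c)).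
  have [s hs] : iso Q' P'.
    have [t1 [t1t tt1]] := ht.
    exact: cA (biproduct_transport b2 t1t tt1) b1.
  have [s' [hs' cs]] := compatible_exists c hs.
  have := MM _ _ (Md _ _ _ _ ht hs') (IH s t' hs ht').
  rewrite (deltaE ht hs') -loop_classM /=.
  have h := iso_edge_comp hs hs' (Ebwd c (ecat p
    (Ebwd (iso_edge ht') (Enil (Gzero A))))) cs.
  congr M; apply/loop_classP/htpy_fwd.
  apply: htpy_trans (htpy_bwdK (iso_edge hs') _); apply: htpy_bwd.
  apply: htpy_trans h; apply: htpy_fwd; exact/htpy_sym/htpy_fwdK.
have [p ->] := loop_class_surj x.
have h0 := isom_id (zob A).
have := H _ _ p _ _ h0 h0; congr M; apply/loop_classP.
apply: htpy_trans (iso_edge_zero h0 _) _.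
rewrite -{2}[p]ecatp0; apply: htpy_catr.
apply: htpy_trans (htpy_bwdK (iso_edge h0) _).
exact/htpy_bwd/htpy_sym/iso_edge_zero.
Qed.

Lemma K1_comm : cancellative A -> forall x y : K1 A, (x * y = y * x)%g.
Proof.
move=> cA; apply: K1_generated => // [x x' hx hx' y|P Q t1 t2 h1 h2].
  by rewrite -mulgA (hx' y) mulgA (hx y) -mulgA.
have [s1 [s11 s12]] := h1.
have hg : isom (t2 \\o s1) by apply: isom_comp => //; exists t1.
rewrite (@delta_aut_class _ _ t1 t2 (t2 \\o s1)) // -?compA ?s11 ?compm1 //.
apply: K1_generated => // [x x' hx hx'|P' Q' t1' t2' h1' h2'].
  by rewrite mulgA hx -mulgA hx' -mulgA.
have [s1' [s11' s12']] := h1'.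
have hg' : isom (t2' \\o s1') by apply: isom_comp => //; exists t1'.
rewrite (@delta_aut_class _ _ t1' t2' (t2' \\o s1')) // -?compA ?s11' ?compm1 //.
exact: aut_class_comm.
Qed.

End AutomorphismClasses.

(** The change of base point in [K1_map] is the edge of an identity, which is
    absorbed by the 2-simplices of compatible isomorphisms. *)
Lemma K1_map_delta (A B : addCat) (F : addFunctor A B) (P Q : A)
    (t1 t2 : hom Q P) :
  isom t1 -> isom t2 -> K1_map F (delta t1 t2) = delta (fhom F t1) (fhom F t2).
Proof.
move=> h1 h2; have h1' := fhom_isom F h1; have h2' := fhom_isom F h2.
rewrite (deltaE h1 h2) (deltaE h1' h2') /K1_map pi1_mapE /=.
apply/loop_classP.
have h0 := isom_id (F (zob A)).
have E (t : hom Q P) (h : isom t) v (p : @epath (Gcons B) (F P, F Q) v) :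
    htpy (Efwd (Gbase (F (zob A))) (Efwd (Gemap F (iso_edge h)) p))
         (Efwd (iso_edge (fhom_isom F h)) p).
  have -> : Gbase (F (zob A)) = iso_edge h0.
    rewrite /Gbase /iso_edge; congr GEdge; congr Conf; exact: Prop_irrelevance.
  apply: iso_edge_comp; split => /=.
    by rewrite fhom0 !compm0 ?fhom0 ?comp0m.
  by rewrite -fhomM comp1m.
apply: htpy_trans (E _ _ _ _) _.
rewrite (Prop_irrelevance (fhom_isom F h1) h1'); apply: htpy_fwd.
apply: htpy_trans (htpy_sym (htpy_bwdK (iso_edge h2') _)) _; apply: htpy_bwd.
rewrite -(Prop_irrelevance (fhom_isom F h2) h2').
apply: htpy_trans (htpy_sym (E _ _ _ _)) _.
apply: htpy_trans (htpy_fwd _ (htpy_fwdK _ _)) _.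
exact: htpy_fwdK.
Qed.

Section K1MapMorphism.
Variables (A B : addCat) (F : addFunctor A B).

Lemma K1_map1 : K1_map F 1%g = 1%g.
Proof. exact: gmulf1. Qed.

Lemma K1_mapM x y : K1_map F (x * y)%g = (K1_map F x * K1_map F y)%g.
Proof. exact: gmulfM. Qed.

Lemma K1_mapV x : K1_map F (x^-1)%g = ((K1_map F x)^-1)%g.
Proof. exact: gmulfV. Qed.

End K1MapMorphism.

(** * Lifting isomorphisms along the quotient functor *)

Section QuotientFunctor.
Variables (A : addCat) (B : addSubcat A).
Implicit Types X Y Z W P Q : A.

Notation AB := (addquot B).

Definition quot_mor X Y (f : hom X Y) : @hom AB X Y := to_quot B f.
Local Notation "'q" := (@quot_mor _ _) (at level 0).

Lemma quot_mor1 X : 'q (idm X) = @idm AB X.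
Proof. by []. Qed.

Lemma quot_morM X Y Z (g : hom Y Z) (f : hom X Y) : 'q (g \\o f) = 'q g \\o 'q f.
Proof. exact: to_quotM_sym. Qed.

Lemma quot_morD X Y (f g : hom X Y) : 'q (f + g) = 'q f + 'q g.
Proof. exact: to_quotD. Qed.

Lemma quot_mor0 X Y : 'q (0 : hom X Y) = 0.
Proof. by apply: (addrI ('q 0)); rewrite -quot_morD !addr0. Qed.

Lemma quot_mor_surj X Y (h : @hom AB X Y) : exists f : hom X Y, h = 'q f.
Proof. exact: to_quot_surj. Qed.

Lemma quot_mor_eqP X Y (f g : hom X Y) :
  'q f = 'q g <-> factors_through B (f - g).
Proof. exact: to_quot_eqP. Qed.

Lemma quot_mor_isom X Y (f : hom X Y) : isom f -> isom ('q f).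
Proof. exact: (fhom_isom (quotient_functor B)). Qed.

Lemma quot_mor_biproduct X Y W (i1 : hom X W) (i2 : hom Y W) (p1 : hom W X)
    (p2 : hom W Y) :
  biproduct i1 i2 p1 p2 -> biproduct ('q i1) ('q i2) ('q p1) ('q p2).
Proof. exact: (fhom_biproduct (quotient_functor B)). Qed.

Lemma quot_zero_object X : B X -> @zero_object AB X.
Proof.
move=> BX; apply/zero_objectP; rewrite -quot_mor1 -quot_mor0.
by apply/quot_mor_eqP; exists X, (idm X), (idm X); rewrite subr0 comp1m.
Qed.

Lemma quot_inj_isom X C V (i : hom X V) (j : hom C V) (r : hom V X)
    (p : hom V C) : biproduct i j r p -> B C -> isom ('q i).
Proof.
move=> bp /quot_zero_object[C0 _]; have bq := quot_mor_biproduct bp.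
exists ('q r); rewrite (biprodE bq); split=> //.
by rewrite -(biprod1 bq) [X in _ = _ + 'q j \\o X]C0 compm0 addr0.
Qed.

Hypothesis sA : split_monos_have_complements A.
Hypothesis hB : summand_closed B.

(** An object of the quotient vanishes only if its identity factors through
    the subcategory, of which it is then a summand. *)
Lemma quot_zero_sub_ob X : @zero_object AB X -> B X.
Proof.
move=> /zero_objectP; rewrite -quot_mor1 -quot_mor0 => /quot_mor_eqP.
move=> [Z [g [h [BZ e]]]]; rewrite subr0 in e.
by have [C [j [r [p bp]]]] := sA (esym e); have [] := hB bp BZ.
Qed.

(** If [g t = 1 + b a] with [b a] factoring through [Z], then [(t, -a)] is a
    split monomorphism into [Y + Z]; its complement vanishes in the quotient. *)
Lemma quot_isom_lift X Y (h : @hom AB X Y) : isom h ->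
  exists (C D V : A) (m : hom X V) (j : hom C V) (r : hom V X) (p : hom V C)
      (i1 : hom Y V) (i2 : hom D V) (p1 : hom V Y) (p2 : hom V D),
    [/\ B C, B D, biproduct m j r p, biproduct i1 i2 p1 p2
      & 'q m = 'q i1 \\o h].
Proof.
have [t ->] := quot_mor_surj h => ht; have [g' [gt _]] := ht.
have [g eg] := quot_mor_surj g'; move: gt; rewrite eg -quot_morM -quot_mor1.
move=> /quot_mor_eqP[Z [a [b [BZ e]]]].
have [V [i1 [i2 [p1 [p2 bV]]]]] := biproductP Y Z.
pose m := i1 \\o t - i2 \\o a; pose R := g \\o p1 + b \\o p2.
have Rm : R \\o m = idm X.
  rewrite /R /m !(compDl, compDr, compmN) -!compA !(biprodE bV) !compm0.
  by rewrite oppr0 addr0 add0r -e opprB addrC subrK.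
have [C [j [r [p bC]]]] := sA Rm.
have [hZ hZ'] := quot_zero_object BZ.
have bVq := quot_mor_biproduct bV; have bCq := quot_mor_biproduct bC.
have qm : 'q m = 'q i1 \\o 'q t.
  rewrite -(comp1m ('q m)) -(biprod1 bVq) compDl -!compA [X in _ + _ \\o X]hZ.
  rewrite compm0 addr0 -quot_morM /m compDr compmN !(compA p1) !(biprodE bV).
  by rewrite comp1m comp0m subr0.
exists C, Z, V, m, j, r, p, i1, i2, p1, p2; split=> //.
apply/quot_zero_sub_ob/zero_objectP.
have hi := quot_inj_isom bV BZ.
have him : isom ('q m) by rewrite qm; exact: isom_comp.
have -> : @idm AB C = 'q p \\o 'q j by rewrite (biprodE bCq).
suff -> : 'q p = 0 by rewrite comp0m.
by apply: (isomIr him); rewrite (biprodE bCq) comp0m.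
Qed.

Hypothesis cA : cancellative A.

(** An isomorphism of [X + C] with [X + D] lifting an automorphism of [X] turns
    into an automorphism because [C] and [D] are isomorphic by cancellation. *)
Lemma quot_aut_lift X (h : @hom AB X X) : isom h ->
  exists (V : A) (f : @hom AB X V) (phi : hom V V),
    [/\ isom f, isom phi & 'q phi \\o f = f \\o h].
Proof.
move=> /quot_isom_lift[C [D [V [m [j [r [p [i1 [i2 [p1 [p2 [BC BD bC bD e]]]]]]]]]]]].
have [u [v [vu uv]]] := cA (biproductC bC) (biproductC bD).
exists V, ('q i1), (m \\o p1 + j \\o v \\o p2); split.
- exact: quot_inj_isom bD BD.
- exists (i1 \\o r + i2 \\o u \\o p).
  rewrite !(compDl, compDr) -!compA !(biprodE bC, biprodE bD) !compm0 !addr0 !add0r.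
  by rewrite (compA u) uv (compA v) vu !comp1m !biprod1.
rewrite -quot_morM !compDl -!compA !(biprodE bD) !compm0 addr0 compm1.
exact: e.
Qed.

(** Both [X] and [Y] embed in the object provided by [quot_isom_lift] with a
    complement in the subcategory, and extending an automorphism by the identity
    of a complement preserves its class. *)
Lemma quot_common_lift X Y (h : @hom AB X Y) (phi : hom X X) (psi : hom Y Y) :
  isom h -> isom phi -> isom psi ->
  exists (V : A) (f : @hom AB X V) (g : @hom AB Y V) (phi' psi' : hom V V),
    [/\ isom g, f = g \\o h, [/\ isom phi', aut_class phi' = aut_class phi
      & 'q phi' \\o f = f \\o 'q phi]
      & [/\ isom psi', aut_class psi' = aut_class psi
      & 'q psi' \\o g = g \\o 'q psi]].
Proof.
move=> hh hphi hpsi.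
have [C [D [V [m [j [r [p [i1 [i2 [p1 [p2 [BC BD bC bD e]]]]]]]]]]]] :=
  quot_isom_lift hh.
have [phi' [h1 c1 e1 _ _]] := aut_class_extend bC hphi.
have [psi' [h2 c2 e2 _ _]] := aut_class_extend bD hpsi.
exists V, ('q m), ('q i1), phi', psi'; split=> //.
- exact: quot_inj_isom bD BD.
- by split=> //; rewrite -!quot_morM e1.
- by split=> //; rewrite -!quot_morM e2.
Qed.

End QuotientFunctor.

(** Endomorphism rings in the quotient are quotients of local rings, hence local
    or zero; in the second case the summand is dropped. *)
Lemma local_sum_quot (A : addCat) (B : addSubcat A) (W : A) :
  local_sum W -> @local_sum (addquot B) W.
Proof.
elim=> {W} [W W0|X L W i1 i2 p1 p2 bp _ IH [nL lL]].
  apply/local_sum0/zero_objectP; move/zero_objectP: W0 => W0.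
  by rewrite -quot_mor1 W0 quot_mor0.
have bq := quot_mor_biproduct B bp.
have [L0|L0] := pselect (@zero_object (addquot B) L).
  apply: local_sum_iso IH _; exists (quot_mor B i1), (quot_mor B p1).
  rewrite (biprodE bq) -(biprod1 bq); split=> //.
  by rewrite [X in _ = _ + _ \\o X](proj1 L0) compm0 addr0.
apply: (local_sumS bq) => //; split; first by move/zero_objectP.
move=> f g; have [f' ->] := quot_mor_surj f; have [g' ->] := quot_mor_surj g.
move=> hf hg [k]; have [k' ->] := quot_mor_surj k.
rewrite -quot_morD -!quot_morM -!quot_mor1 => -[].
move=> /quot_mor_eqP e1 /quot_mor_eqP e2.
have unit (x : hom L L) : factors_through B (x - idm L) -> isom x.
  move=> [Z [a [b [BZ e]]]].
  have : isom (x + - (b \\o a)) by rewrite -e opprB addrC subrK; exact: isom_id.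
  case/(local_endD (conj nL lL)) => // /isomN[c [_ c2]].
  case: L0; apply/zero_objectP; rewrite -quot_mor1 -c2 -!compA !quot_morM.
  by rewrite [X in _ \\o X](proj1 (quot_zero_object BZ)) compm0.
have hfg : isom (f' + g').
  have [c1 [c11 c12]] := unit _ e1; have [c2 [c21 c22]] := unit _ e2.
  have c1k : c1 \\o k' = k' \\o c2.
    by rewrite -(compm1 (c1 \\o k')) -c22 -!compA (compA k') (compA c1) c11 comp1m.
  by exists (c1 \\o k'); rewrite -compA c11 c1k compA c22.
apply: (lL f' g') hfg => /(quot_mor_isom B); first exact: hf.
exact: hg.
Qed.

(** * Exactness of the sequence of K_1 *)

Section K1Exactness.
Variables (A : addCat) (B : addSubcat A).
Hypothesis sA : split_monos_have_complements A.
Hypothesis hB : summand_closed B.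
Hypothesis cA : cancellative A.
Hypothesis cAB : cancellative (addquot B).
Implicit Types X Y Z W P Q : A.

Notation AB := (addquot B).
Local Notation "'q" := (@quot_mor A B _ _) (at level 0).

Lemma fullsub_cancellative : cancellative (fullsub B).
Proof.
move=> X Y Z W i1 i2 p1 p2 j1 j2 q1 q2 [a1 a2 a3 a4 a5] [b1 b2 b3 b4 b5].
by apply: (@cA (sval X) (sval Y) (sval Z) (sval W) i1 i2 p1 p2 j1 j2 q1 q2).
Qed.

(** Objects of the subcategory vanish in the quotient, where any two isomorphisms
    between them are therefore equal. *)
Lemma K1_map_inclusion_quotient (n : K1 (fullsub B)) :
  K1_map (quotient_functor B) (K1_map (inclusion B) n) = 1%g.
Proof.
move: n; apply: (K1_generated fullsub_cancellative) => [x y hx hy|P Q t1 t2 h1 h2].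
  by rewrite !K1_mapM hx hy mulg1.
rewrite !K1_map_delta //; try exact: (fhom_isom (inclusion B)).
have [z _] := quot_zero_object (svalP P).
rewrite [X in delta X _]z [X in delta _ X]z; exact: delta_refl.
Qed.

Lemma K1_quotient_surjective (y : K1 AB) :
  exists x, K1_map (quotient_functor B) x = y.
Proof.
move: y; apply: (K1_generated cAB) => [x y [x' <-] [y' <-]|P Q t1 t2 h1 h2].
  by exists (x' * y')%g; rewrite K1_mapM.
have [s1 [s11 s12]] := h1.
have hs : isom (t2 \\o s1) by apply: isom_comp => //; exists t1.
have [W [f [phi [hf hphi e]]]] := quot_aut_lift sA hB cA hs.
exists (aut_class phi); rewrite K1_map_delta //; last exact: isom_id.
apply: (delta_iso (f := f) (g := f \\o t1)) => //.
- exact: isom_comp.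
- exact: isom_id.
- exact: quot_mor_isom.
- by rewrite comp1m.
- by rewrite compA [X in X \\o _]e -!compA s11 compm1.
Qed.

Definition eqmod (x y : K1 A) : Prop :=
  exists n : K1 (fullsub B), x = (y * K1_map (inclusion B) n)%g.

Lemma eqmod_refl x : eqmod x x.
Proof. by exists 1%g; rewrite K1_map1 mulg1. Qed.

Lemma eqmod_sym x y : eqmod x y -> eqmod y x.
Proof. by move=> [n ->]; exists (n^-1)%g; rewrite K1_mapV mulgK. Qed.

Lemma eqmod_trans y x z : eqmod x y -> eqmod y z -> eqmod x z.
Proof. by move=> [n ->] [k ->]; exists (k * n)%g; rewrite K1_mapM mulgA. Qed.

Lemma eqmodM x x' y y' : eqmod x x' -> eqmod y y' -> eqmod (x * y)%g (x' * y')%g.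
Proof.
move=> [n ->] [k ->]; exists (n * k)%g; rewrite K1_mapM -!mulgA; congr (_ * _)%g.
by rewrite !mulgA; congr (_ * _)%g; exact: K1_comm.
Qed.

Lemma eqmodV x y : eqmod x y -> eqmod (x^-1)%g (y^-1)%g.
Proof.
by move=> [n ->]; exists (n^-1)%g; rewrite K1_mapV invgM; exact: K1_comm.
Qed.

(** Two such automorphisms differ by some [1 + b a] where [b a] factors through
    [Z] in the subcategory, and [1 + b a] has the class of the automorphism
    [1 + a b] of [Z]. *)
Lemma aut_class_eqmod X (f g : hom X X) :
  isom f -> isom g -> 'q f = 'q g -> eqmod (aut_class f) (aut_class g).
Proof.
move=> hf hg e; have [g' [g'g gg']] := hg.
have hg' : isom g' by exists g.
have /quot_mor_eqP[Z [a [b [BZ eba]]]] : 'q (g' \\o f) = 'q (idm X).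
  by rewrite quot_morM e -quot_morM g'g.
have fE : f = g \\o (idm X + b \\o a).
  by rewrite -eba addrC subrK compA gg' comp1m.
have hu : isom (idm X + b \\o a).
  by rewrite -eba addrC subrK; exact: isom_comp.
have [hv euv] := aut_class_swap hu.
rewrite fE aut_classM // euv.
pose Z' : fullsub B := exist _ Z BZ.
exists (@aut_class (fullsub B) Z' (idm Z + a \\o b)); congr (_ * _)%g.
rewrite [RHS]K1_map_delta //.
exact: (isom_id Z').
Qed.

(** [x] is the class of an automorphism of [A] lifting [t2 t1^-1], up to an
    isomorphism of the quotient. *)
Definition lift_class P Q (t1 t2 : @hom AB Q P) (x : K1 A) : Prop :=
  exists (W : A) (f : @hom AB P W) (phi : hom W W),
    [/\ isom f, isom phi, 'q phi \\o (f \\o t1) = f \\o t2 & x = aut_class phi].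

Lemma lift_class_exists P Q (t1 t2 : @hom AB Q P) :
  isom t1 -> isom t2 -> exists x, lift_class t1 t2 x.
Proof.
move=> h1 h2; have [s1 [s11 s12]] := h1.
have hs : isom (t2 \\o s1) by apply: isom_comp => //; exists t1.
have [W [f [phi [hf hphi e]]]] := quot_aut_lift sA hB cA hs.
exists (aut_class phi), W, f, phi; split=> //.
by rewrite compA e -!compA s11 compm1.
Qed.

(** Both automorphisms are first moved to a common object of [A]. *)
Lemma lift_classM P Q (t1 t2 t3 : @hom AB Q P) x y :
  lift_class t1 t2 x -> lift_class t2 t3 y -> lift_class t1 t3 (x * y)%g.
Proof.
move=> [W [f [phi [hf hphi e ->]]]] [W' [f' [psi [hf' hpsi e' ->]]]].
have [g [gf fg]] := hf.
have hh : isom (f' \\o g) by apply: isom_comp => //; exists f.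
have [V [k [k' [phi' [psi' [hk' ek [h1 c1 e1] [h2 c2 e2]]]]]]] :=
  quot_common_lift sA hB hh hphi hpsi.
have ekf : k \\o f = k' \\o f' by rewrite ek -!compA gf compm1.
exists V, (k' \\o f'), (psi' \\o phi'); split.
- exact: isom_comp.
- exact: isom_comp.
- rewrite quot_morM -compA -{1}ekf -(compA k f) (compA ('q phi')) e1 -(compA k).
  by rewrite e (compA k) ekf -(compA k') (compA ('q psi')) e2 -(compA k') e' compA.
- by rewrite aut_classM // c1 c2; exact: K1_comm.
Qed.

Lemma lift_class_unique P Q (t1 t2 : @hom AB Q P) x y :
  isom t1 -> lift_class t1 t2 x -> lift_class t1 t2 y -> eqmod x y.
Proof.
move=> ht1 [W [f [phi [hf hphi e ->]]]] [W' [f' [psi [hf' hpsi e' ->]]]].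
have [g [gf fg]] := hf.
have hh : isom (f' \\o g) by apply: isom_comp => //; exists f.
have [V [k [k' [phi' [psi' [hk' ek [h1 c1 e1] [h2 c2 e2]]]]]]] :=
  quot_common_lift sA hB hh hphi hpsi.
have ekf : k \\o f = k' \\o f' by rewrite ek -!compA gf compm1.
rewrite -c1 -c2; apply: aut_class_eqmod => //.
have hF : isom (k' \\o f' \\o t1) by do 2 apply: isom_comp => //.
apply: (isomIr hF).
transitivity (k' \\o f' \\o t2).
  by rewrite -ekf -(compA k f) compA e1 -(compA k) e compA.
rewrite -(compA k' f' t1) (compA ('q psi')) e2 -(compA k' ('q psi)).
by rewrite e' compA.
Qed.

Lemma lift_class_delta P Q (t1 t2 : hom Q P) :
  isom t1 -> isom t2 -> lift_class ('q t1) ('q t2) (delta t1 t2).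
Proof.
move=> h1 h2; have [s1 [s11 s12]] := h1.
have hs : isom (t2 \\o s1) by apply: isom_comp => //; exists t1.
exists P, (@idm AB P), (t2 \\o s1); split=> //; first exact: isom_id.
  by rewrite !comp1m -quot_morM -compA s11 compm1.
by apply: delta_aut_class => //; rewrite -compA s11 compm1.
Qed.

(** The automorphism [t2' t1'^-1] is block triangular with diagonal blocks
    [t2 t1^-1] and 1, hence lifts to a block triangular automorphism. *)
Lemma lift_class_compatible (u v : AB * AB) (c : Gedge u v)
    (t1 t2 : @hom AB u.2 u.1) (t1' t2' : @hom AB v.2 v.1) x :
  isom t1 -> isom t1' -> isom t2' -> compatible c t1 t1' -> compatible c t2 t2' ->
  lift_class t1 t2 x -> lift_class t1' t2' x.
Proof.
case: u v c t1 t2 t1' t2' => [P Q] [P' Q'] [C [i1 p1 c1] [i2 p2 c2]].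
move=> t1 t2 t1' t2' h1 h1' h2' [e e'] [f f'].
have e1 : t1' \\o i2 = i1 \\o t1 := e; have e2 : p1 \\o t1' = p2 := e'.
have e3 : t2' \\o i2 = i1 \\o t2 := f; have e4 : p1 \\o t2' = p2 := f'.
move=> {e e' f f'}.
have [j1 [r1 b1]] := proj1 (conflationP _ _) c1.
move=> [W [f [phi [hf hphi e ->]]]].
have [s1 [s11 s12]] := h1; have [T [T1 T2]] := h1'; have [g [gf fg]] := hf.
have [V [k [l [r [p bV]]]]] := biproductP W C.
have bq := quot_mor_biproduct B bV.
pose F := 'q k \\o f \\o r1 + 'q l \\o p1.
pose F' := i1 \\o g \\o 'q r + j1 \\o 'q p.
have F'F : F' \\o F = idm _.
  rewrite !(compDl, compDr) -!compA !(biprodE bq) !compm0 addr0 add0r.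
  by rewrite (compA g) gf comp1m biprod1.
have FF' : F \\o F' = idm _.
  rewrite !(compDl, compDr) -!compA !(biprodE b1) !compm0 addr0 add0r.
  by rewrite (compA f) fg comp1m biprod1.
have hF : isom F by exists F'.
have Fi : F \\o i1 = 'q k \\o f.
  by rewrite compDl -!compA !(biprodE b1) compm0 compm1 addr0.
have pF : 'q p \\o F = p1.
  by rewrite compDr -!compA !(biprodE bq) add0r.
pose psi := F \\o t2' \\o T \\o F'.
have psiF : psi \\o F = F \\o t2' \\o T by rewrite /psi -!compA F'F compm1.
move: psi psiF => psi psiF.
have Ti : T \\o i1 = i2 \\o s1.
  by rewrite -(compm1 i1) -s12 (compA i1) -e1 -!compA (compA T) T1 comp1m.
have psik : psi \\o 'q k = 'q k \\o 'q phi.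
  apply: (isomIr hf); rewrite -compA -Fi compA psiF -!compA Ti (compA t2') e3.
  rewrite !compA Fi -!compA; congr (_ \\o _).
  by rewrite compA -e -!compA s12 compm1.
have ppsi : 'q p \\o psi = 'q p.
  apply: (isomIr hF); rewrite -compA psiF !compA pF e4 -e2.
  by rewrite -!compA T2 compm1.
have [z ez] := quot_mor_surj ('q r \\o psi \\o 'q l).
have [phi' [hphi' cphi' phik phil _]] := aut_class_extend bV hphi.
have hu := isom_unipotent z bV.
exists V, F, ((idm V + k \\o z \\o p) \\o phi'); split=> //.
- exact: isom_comp.
- suff -> : 'q ((idm V + k \\o z \\o p) \\o phi') = psi.
    by rewrite (compA psi) psiF -!compA T1 compm1.
  apply: (biprod_epi bq).
    rewrite -quot_morM -compA phik compA compDl -!compA (biprodE bV) !compm0 addr0.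
    by rewrite comp1m quot_morM psik.
  rewrite -quot_morM -compA phil compDl -!compA (biprodE bV) compm1 comp1m.
  rewrite quot_morD quot_morM -ez; apply: (biprod_mono bq).
    by rewrite compDr !(biprodE bq) add0r compA.
  by rewrite compDr !(biprodE bq) addr0 compA ppsi (biprodE bq).
- by rewrite aut_classM // (aut_class_unipotent z bV) mul1g.
Qed.

Lemma lift_class_refl P Q (t : @hom AB Q P) : lift_class t t 1%g.
Proof.
exists P, (@idm AB P), (idm P); split; try exact: isom_id.
  by rewrite quot_mor1 comp1m.
by rewrite aut_class1.
Qed.

Definition lift_value P Q (t1 t2 : @hom AB Q P) : K1 A :=
  match pselect (exists x, lift_class t1 t2 x) with
  | left h => projT1 (cid h)
  | right _ => 1%g
  end.

Lemma lift_valueP P Q (t1 t2 : @hom AB Q P) :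
  isom t1 -> isom t2 -> lift_class t1 t2 (lift_value t1 t2).
Proof.
move=> h1 h2; rewrite /lift_value; case: pselect => [h|[]].
  exact: projT2 (cid h).
exact: lift_class_exists.
Qed.

(** By cancellation these are the vertices in the connected component of the base
    point. *)
Definition balanced (u : Gcons AB) : Prop :=
  exists t : @hom AB u.2 u.1, isom t.

(** Reference isomorphisms between the two objects of a vertex; the choice is
    arbitrary, and 0 stands for it at the vertices without one. *)
Definition base_iso (u : Gcons AB) : @hom AB u.2 u.1 :=
  match pselect (balanced u) with
  | left h => projT1 (cid h)
  | right _ => 0
  end.

Lemma base_isoP u : balanced u -> isom (base_iso u).
Proof.
rewrite /base_iso => hu; case: pselect => [h|//]; exact: projT2 (cid h).
Qed.

Definition next_iso (u v : Gcons AB) (c : edge u v) : @hom AB v.2 v.1 :=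
  match pselect (exists t', isom t' /\ compatible c (base_iso u) t') with
  | left h => projT1 (cid h)
  | right _ => 0
  end.

Lemma next_isoP (u v : Gcons AB) (c : edge u v) : balanced u ->
  isom (next_iso c) /\ compatible c (base_iso u) (next_iso c).
Proof.
move=> /base_isoP hu; rewrite /next_iso; case: pselect => [h|[]].
  exact: projT2 (cid h).
exact: compatible_exists.
Qed.

(** The class of the automorphism comparing the isomorphism transported along the
    edge with the reference isomorphism at its end. *)
Definition edge_value (u v : Gcons AB) (c : edge u v) : K1 A :=
  lift_value (next_iso c) (base_iso v).

Lemma edge_value_eqmod (u v : Gcons AB) (c : edge u v) (t : @hom AB v.2 v.1) x :
  balanced u -> isom t -> compatible c (base_iso u) t ->
  lift_class t (base_iso v) x -> eqmod (edge_value c) x.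
Proof.
move=> hu ht ct lx.
have [hn cn] := next_isoP c hu.
have hv : isom (base_iso v) by apply: base_isoP; exists t.
have l1 := lift_class_compatible (base_isoP hu) hn ht cn ct (lift_class_refl _).
have := lift_classM l1 lx; rewrite mul1g => lx'.
exact: lift_class_unique hn (lift_valueP hn hv) lx'.
Qed.

Lemma balanced_fwd (u v : Gcons AB) (c : edge u v) : balanced u -> balanced v.
Proof. by move=> [t ht]; have [t' [ht' _]] := compatible_exists c ht; exists t'. Qed.

Lemma balanced_bwd (u v : Gcons AB) (c : edge u v) : balanced v -> balanced u.
Proof.
move=> [t [s [st ts]]].
have [j1 [r1 b1]] := proj1 (conflationP _ _) (confP (gconf1 c)).
have [j2 [r2 b2]] := proj1 (conflationP _ _) (confP (gconf2 c)).
exact: cAB (biproduct_transport b2 st ts) b1.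
Qed.

(** By [face_compatible] one isomorphism at [w] is compatible with both ways
    around the 2-simplex. *)
Lemma edge_value_face (u v w : Gcons AB) (a : edge u v) (b : edge v w)
    (c : edge u w) :
  balanced u -> face a b c ->
  eqmod (edge_value c) (edge_value a * edge_value b)%g.
Proof.
move=> hu fabc; have hv := balanced_fwd a hu; have hw := balanced_fwd b hv.
have [ha ca] := next_isoP a hu; have [hb cb] := next_isoP b hv.
have [t [ht cbt cct]] := face_compatible fabc ha ca.
apply: (edge_value_eqmod hu ht cct).
apply: lift_classM (lift_valueP hb (base_isoP hw)).
move: (lift_valueP ha (base_isoP hv)); rewrite -/(edge_value a) => la.
exact: lift_class_compatible ha ht hb cbt cb la.
Qed.

Fixpoint path_value (u v : Gcons AB) (p : epath u v) : K1 A :=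
  match p with
  | Enil _ => 1%g
  | Efwd _ _ _ a p => (edge_value a * path_value p)%g
  | Ebwd _ _ _ a p => ((edge_value a)^-1 * path_value p)%g
  end.

Lemma path_value_cat (u v w : Gcons AB) (p : epath u v) (q : epath v w) :
  path_value (ecat p q) = (path_value p * path_value q)%g.
Proof.
elim: p q => [x|x y z a p IH|x y z a p IH] q /=; first by rewrite mul1g.
  by rewrite IH mulgA.
by rewrite IH mulgA.
Qed.

Lemma path_value_htpy (u v : Gcons AB) (p q : epath u v) :
  balanced u -> htpy p q -> eqmod (path_value p) (path_value q).
Proof.
move=> hu h; elim: h hu => {u v p q} /=.
- by move=> *; exact: eqmod_refl.
- by move=> u v p q _ IH hu; exact/eqmod_sym/IH.
- by move=> u v p q r _ IH _ IH' hu; apply: eqmod_trans (IH hu) (IH' hu).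
- move=> u v w a p q _ IH hu; apply: eqmodM (eqmod_refl _) _.
  exact/IH/(balanced_fwd a).
- move=> u v w a p q _ IH hu; apply: eqmodM (eqmod_refl _) _.
  exact/IH/(balanced_bwd a).
- by move=> u v w a p _; rewrite mulgA mulgV mul1g; exact: eqmod_refl.
- by move=> u v w a p _; rewrite mulgA mulVg mul1g; exact: eqmod_refl.
move=> u v w t a b c p fabc hu; rewrite mulgA.
apply: eqmodM (eqmod_refl _); apply: eqmod_sym; exact: edge_value_face.
Qed.

Lemma edge_value_iso_edge P Q (t : @hom AB Q P) (ht : isom t) :
  eqmod (edge_value (iso_edge ht)) (lift_value t (base_iso (P, Q))).
Proof.
have h0 : balanced (Gzero AB) by exists (@idm AB (zob A)); exact: isom_id.
have hv : balanced (P, Q) by exists t.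
apply: (@edge_value_eqmod (Gzero AB) (P, Q) (iso_edge ht) t _ h0 ht);
  last exact: lift_valueP ht (base_isoP hv).
exact: iso_edge_compatible.
Qed.

(** It suffices to treat the generators [delta t1 t2], on which the contributions
    of the reference isomorphism at (P, Q) cancel. *)
Lemma path_value_K1_map (x : K1 A) (p : epath (Gzero AB) (Gzero AB)) :
  loop_class p = K1_map (quotient_functor B) x -> eqmod (path_value p) x.
Proof.
have h0 : balanced (Gzero AB) by exists (@idm AB (zob A)); exact: isom_id.
move: x p; apply: (K1_generated cA) => [x y hx hy|P Q t1 t2 h1 h2] p.
  have [p1 e1] := loop_class_surj (K1_map (quotient_functor B) x).
  have [p2 e2] := loop_class_surj (K1_map (quotient_functor B) y).
  rewrite K1_mapM e1 e2 -loop_classM => /loop_classP /(path_value_htpy h0).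
  move=> /eqmod_trans; apply; rewrite path_value_cat.
  by apply: eqmodM; [exact: hx|exact: hy].
have h1' := quot_mor_isom B h1; have h2' := quot_mor_isom B h2.
rewrite K1_map_delta // (deltaE h1' h2') => /loop_classP /(path_value_htpy h0).
move=> /eqmod_trans; apply; rewrite /= mulg1.
have hv : isom (base_iso (P, Q)) by apply: base_isoP; exists ('q t1).
have l1 := lift_valueP h1' hv; have l2 := lift_valueP h2' hv.
apply: eqmod_trans (eqmodM (edge_value_iso_edge h1')
  (eqmodV (edge_value_iso_edge h2'))) _.
have := lift_classM (lift_class_delta h1 h2) l2.
move=> /(lift_class_unique h1' l1) h.
apply: eqmod_trans (eqmodM h (eqmod_refl _)) _.
rewrite mulgK; exact: eqmod_refl.
Qed.

Lemma K1_kernel (x : K1 A) :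
  K1_map (quotient_functor B) x = 1%g ->
  exists n, K1_map (inclusion B) n = x.
Proof.
move=> x1; have : loop_class (Enil (Gzero AB)) = K1_map (quotient_functor B) x.
  by rewrite x1 loop_class1.
by move=> /path_value_K1_map /eqmod_sym [n ->]; exists n; rewrite mul1g.
Qed.

End K1Exactness.

(** * K_0 and isomorphism classes *)

Section K0Classes.
Variable A : addCat.
Implicit Types X Y Z W : A.

Definition K0_class X : K0 A := \pi_(K0 A) (ob_class X).

Lemma K0_piP (x y : {freeg {classic A}}) :
  \pi_(K0 A) x = \pi_(K0 A) y <-> K0_relation (x - y).
Proof.
by split=> [/eqP|/asboolP h]; [|apply/eqP]; rewrite -Quotient.idealrBE // => /asboolP.
Qed.

Lemma K0_class_biproduct X Y W (i1 : hom X W) (i2 : hom Y W) (p1 : hom W X)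
    (p2 : hom W Y) :
  biproduct i1 i2 p1 p2 -> K0_class W = K0_class X + K0_class Y.
Proof.
move=> /biproduct_conflation h; rewrite /K0_class -raddfD; apply/K0_piP.
exact: K0_rel_conflation h.
Qed.

Lemma biproduct_iso0 X Y (f : hom X Y) (g : hom Y X) :
  g \\o f = idm X -> f \\o g = idm Y ->
  biproduct f (0 : hom (zob A) Y) g (0 : hom Y (zob A)).
Proof.
move=> gf fg; split; rewrite ?comp0m ?compm0 ?addr0 //.
by rewrite [RHS](proj1 (zobP A)).
Qed.

Lemma K0_class0 : K0_class (zob A) = 0.
Proof.
have id0 := comp1m (idm (zob A)).
apply: (addrI (K0_class (zob A))); rewrite addr0.
by rewrite -(K0_class_biproduct (biproduct_iso0 id0 id0)).
Qed.

Lemma K0_class_iso X Y : iso X Y -> K0_class X = K0_class Y.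
Proof.
move=> [f [g [gf fg]]]; rewrite (K0_class_biproduct (biproduct_iso0 gf fg)).
by rewrite K0_class0 addr0.
Qed.

Lemma K0_class_surj (x : K0 A) : exists X Y, x = K0_class X - K0_class Y.
Proof.
pose M (x : K0 A) := exists X Y, x = K0_class X - K0_class Y.
have MD x1 x2 : M x1 -> M x2 -> M (x1 + x2).
  move=> [X [Y ->]] [X' [Y' ->]].
  have [V [i1 [i2 [p1 [p2 b1]]]]] := biproductP X X'.
  have [W [j1 [j2 [q1 [q2 b2]]]]] := biproductP Y Y'.
  exists V, W; rewrite (K0_class_biproduct b1) (K0_class_biproduct b2).
  by rewrite opprD addrACA.
have MN x1 : M x1 -> M (- x1) by move=> [X [Y ->]]; exists Y, X; rewrite opprB.
have M0 : M 0 by exists (zob A), (zob A); rewrite subrr.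
have Mn X n : M (K0_class X *+ n).
  elim: n => [|n IH]; first by rewrite mulr0n.
  rewrite mulrS; apply: MD => //; exists X, (zob A).
  by rewrite K0_class0 subr0.
rewrite -/(M x) -[x]reprK -[repr x]freeg_sumE raddf_sum.
apply: (big_ind M) => // X _.
have -> : << coeff X (repr x) *g X >> = (ob_class (X : A)) *~ coeff X (repr x).
  by rewrite /ob_class freegU_mulz intz.
rewrite raddfMz; case: (coeff _ _) => n; first exact: Mn.
exact/MN/Mn.
Qed.

Definition oplus X Y : A := projT1 (cid (biproductP X Y)).

Lemma oplusP X Y : exists i1 i2 p1 p2, @biproduct A X Y (oplus X Y) i1 i2 p1 p2.
Proof. exact: projT2 (cid (biproductP X Y)). Qed.

Definition osum (s : seq {classic A}) : A := foldr oplus (zob A) s.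

Lemma biproduct_iso X Y W X' Y' W' (i1 : hom X W) (i2 : hom Y W) (p1 : hom W X)
    (p2 : hom W Y) (j1 : hom X' W') (j2 : hom Y' W') (q1 : hom W' X')
    (q2 : hom W' Y') :
  biproduct i1 i2 p1 p2 -> biproduct j1 j2 q1 q2 -> iso X X' -> iso Y Y' ->
  iso W W'.
Proof.
move=> bi bj [f [f' [f1 f2]]] [g [g' [g1 g2]]].
exists (j1 \\o f \\o p1 + j2 \\o g \\o p2), (i1 \\o f' \\o q1 + i2 \\o g' \\o q2).
rewrite !(compDl, compDr) -!compA !(biprodE bi, biprodE bj) !compm0.
rewrite !addr0 !add0r (compA f') f1 (compA g') g1 (compA f) f2 (compA g) g2.
by rewrite !comp1m !biprod1.
Qed.

Lemma oplus_iso X Y X' Y' : iso X X' -> iso Y Y' -> iso (oplus X Y) (oplus X' Y').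
Proof.
have [i1 [i2 [p1 [p2 b]]]] := oplusP X Y.
have [i1' [i2' [p1' [p2' b']]]] := oplusP X' Y'.
exact: biproduct_iso b b'.
Qed.

Lemma oplusCA X Y Z : iso (oplus X (oplus Y Z)) (oplus Y (oplus X Z)).
Proof.
have [i1 [i2 [p1 [p2 b1]]]] := oplusP Y Z.
have [j1 [j2 [q1 [q2 b2]]]] := oplusP X (oplus Y Z).
have [k1 [k2 [r1 [r2 b3]]]] := oplusP X Z.
have b : biproduct (j2 \\o i1) (j1 \\o r1 + j2 \\o i2 \\o r2) (p1 \\o q2)
    (k1 \\o q1 + k2 \\o p2 \\o q2).
  split; rewrite ?(compDl, compDr) -!compA.
  - by rewrite !(biprodE b2) (biprodE b1).
  - rewrite !(biprodE b2) !compm0 !(biprodE b1) addr0 add0r.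
    by rewrite biprod1.
  - by rewrite !(biprodE b2) !(biprodE b1) compm0 addr0.
  - by rewrite !(biprodE b2) !(biprodE b1) !compm0 addr0.
  rewrite !(biprodE b3) !compm0 addr0 add0r addrCA -compDr !(compA _ _ q2).
  by rewrite -compDl biprod1 // comp1m biprod1.
have [l1 [l2 [t1 [t2 b4]]]] := oplusP Y (oplus X Z).
exact: biproduct_iso b b4 (iso_refl _) (iso_refl _).
Qed.

Lemma osum_cons_cat (X : {classic A}) s t : iso (osum (s ++ X :: t)) (osum (X :: s ++ t)).
Proof.
elim: s => [|Y s IH] /=; first exact: iso_refl.
apply: iso_trans (oplus_iso (iso_refl Y) IH) _; exact: oplusCA.
Qed.

Lemma osum_cat_iso s t u v : iso (osum s) (osum t) -> iso (osum u) (osum v) ->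
  iso (osum (s ++ u)) (osum (t ++ v)).
Proof.
have H x y : exists i1 i2 p1 p2, @biproduct A (osum x) (osum y) (osum (x ++ y)) i1 i2 p1 p2.
  elim: x => [|X x [i1 [i2 [p1 [p2 b]]]]] /=.
    have id0 := comp1m (idm (osum y)).
    exists 0, (idm _), 0, (idm _); exact: biproductC (biproduct_iso0 id0 id0).
  have [j1 [j2 [q1 [q2 b1]]]] := oplusP X (osum x).
  have [k1 [k2 [r1 [r2 b2]]]] := oplusP X (osum (x ++ y)).
  exists (k1 \\o q1 + k2 \\o i1 \\o q2), (k2 \\o i2),
    (j1 \\o r1 + j2 \\o p1 \\o r2), (p2 \\o r2).
  split; rewrite ?(compDl, compDr) -!compA.
  - rewrite !(biprodE b2) !compm0 !(biprodE b) addr0 add0r.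
    by rewrite biprod1.
  - by rewrite !(biprodE b2) (biprodE b).
  - by rewrite !(biprodE b2) !(biprodE b) !compm0 addr0.
  - by rewrite !(biprodE b2) !(biprodE b) compm0 addr0.
  rewrite !(biprodE b1) !compm0 addr0 add0r -addrA -compDr !(compA _ _ r2).
  by rewrite -compDl biprod1 // comp1m biprod1.
have [i1 [i2 [p1 [p2 b]]]] := H s u; have [j1 [j2 [q1 [q2 b']]]] := H t v.
exact: biproduct_iso b b'.
Qed.

Lemma osum_perm s t : perm_eq s t -> iso (osum s) (osum t).
Proof.
elim: s t => [|X s IH] t; first by rewrite perm_sym => /perm_nilP ->; exact: iso_refl.
move=> p; have Xt : X \in t by rewrite -(perm_mem p) mem_head.
case/splitPr: Xt p => t1 t2 p.
apply: iso_trans (iso_sym (osum_cons_cat _ _ _)).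
apply: oplus_iso (iso_refl X) (IH _ _).
rewrite -(perm_cons X); apply: perm_trans p _.
by rewrite -cat1s perm_catCA.
Qed.

Definition class_sum (s : seq {classic A}) : {freeg {classic A}} :=
  \sum_(X <- s) ob_class X.

Lemma coeff_class_sum (X : {classic A}) s : coeff X (class_sum s) = (count_mem X s)%:Z.
Proof.
rewrite /class_sum raddf_sum /=; elim: s => [|Y s IH]; first by rewrite big_nil.
by rewrite big_cons IH coeffU mul1r /= PoszD natz.
Qed.

Lemma class_sum_inj s t : class_sum s = class_sum t -> perm_eq s t.
Proof.
move=> e; apply/allP => X _ /=; move/(congr1 (coeff X)): e.
by rewrite !coeff_class_sum => -[->].
Qed.

(** Differences of class sums with isomorphic direct sums are stable under
    subtraction, so relations can be followed by induction. *)
Lemma K0_relation_osum x : K0_relation x ->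
  exists s t, x = class_sum s - class_sum t /\ iso (osum s) (osum t).
Proof.
elim=> {x} [X Y Z i p h||x y _ [s [t [-> st]]] _ [s' [t' [-> st']]]].
- have [j [r b]] := proj1 (conflationP _ _) h.
  exists [:: (Y : {classic A})], [:: (X : {classic A}); (Z : {classic A})].
  split; first by rewrite /class_sum !big_cons !big_nil !addr0.
  have [i1 [i2 [p1 [p2 b1]]]] := oplusP Y (zob A).
  have [j1 [j2 [q1 [q2 b2]]]] := oplusP X (oplus Z (zob A)).
  have [k1 [k2 [r1 [r2 b3]]]] := oplusP Z (zob A).
  have id0 (T : A) := comp1m (idm T).
  have isoY := biproduct_iso b1 (biproduct_iso0 (id0 Y) (id0 Y)) (iso_refl _) (iso_refl _).
  have isoZ := biproduct_iso (biproduct_iso0 (id0 Z) (id0 Z)) b3 (iso_refl _) (iso_refl _).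
  exact: iso_trans isoY (biproduct_iso b b2 (iso_refl _) isoZ).
- by exists [::], [::]; rewrite subrr; split=> //; exact: iso_refl.
exists (s ++ t'), (t ++ s'); split; last exact/osum_cat_iso/iso_sym.
by rewrite /class_sum !big_cat /= opprB opprD addrACA.
Qed.

(** In the free group, the relation says that [X :: t] and [Y :: s] agree as
    multisets; the isomorphic sums of [s] and [t] are then cancelled. *)
Lemma K0_class_eq_iso X Y : cancellative A -> K0_class X = K0_class Y -> iso X Y.
Proof.
move=> cA /K0_piP /K0_relation_osum[s [t [e st]]].
have /class_sum_inj/osum_perm /= h :
    class_sum ((X : {classic A}) :: t) = class_sum ((Y : {classic A}) :: s).
  rewrite /class_sum !big_cons; move/eqP: e; rewrite subr_eq => /eqP ->.
  by rewrite addrAC subrK addrC.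
have [i1 [i2 [p1 [p2 b1]]]] := oplusP X (osum t).
have [j1 [j2 [q1 [q2 b2]]]] := oplusP Y (osum t).
have [f [g [gf fg]]] : iso (oplus X (osum t)) (oplus Y (osum t)).
  apply: iso_trans h _; exact: oplus_iso (iso_refl _) st.
exact: cA (biproduct_transport b1 gf fg) b2.
Qed.

End K0Classes.

(** * Exactness of the sequence of K_0 *)

Section K0Exactness.

Lemma K0_map_class (A B : addCat) (F : addFunctor A B) (X : A) :
  K0_map F (K0_class X) = K0_class (F X).
Proof. by rewrite K0_mapE K0_lift_class. Qed.

Lemma K0_mapB (A B : addCat) (F : addFunctor A B) (X Y : A) :
  K0_map F (K0_class X - K0_class Y) = K0_class (F X) - K0_class (F Y).
Proof. by rewrite K0_map_zmod_morphism !K0_map_class. Qed.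

Variables (A : addCat) (B : addSubcat A).
Hypothesis sA : split_monos_have_complements A.
Hypothesis hB : summand_closed B.
Hypothesis cA : cancellative A.
Hypothesis cAB : cancellative (addquot B).

Lemma K0_inclusion_inj (x : K0 (fullsub B)) : K0_map (inclusion B) x = 0 -> x = 0.
Proof.
have [X [Y ->]] := K0_class_surj x; rewrite K0_mapB => /eqP.
rewrite subr_eq0 => /eqP /(K0_class_eq_iso cA)[f [g [gf fg]]].
apply/eqP; rewrite subr_eq0; apply/eqP/K0_class_iso.
by exists f, g.
Qed.

Lemma K0_map_inclusion_quotient (x : K0 (fullsub B)) :
  K0_map (quotient_functor B) (K0_map (inclusion B) x) = 0.
Proof.
have [X [Y ->]] := K0_class_surj x; rewrite !K0_mapB.
apply/eqP; rewrite subr_eq0; apply/eqP/K0_class_iso; exists 0.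
by apply: zero_object_isom; apply: quot_zero_object; exact: svalP.
Qed.

(** If [X + C] and [Y + D] are isomorphic, then the class of [X] minus that of [Y]
    is the class of [D] minus that of [C]. *)
Lemma K0_kernel (y : K0 A) : K0_map (quotient_functor B) y = 0 ->
  exists x, K0_map (inclusion B) x = y.
Proof.
have [X [Y ->]] := K0_class_surj y; rewrite K0_mapB => /eqP.
rewrite subr_eq0 => /eqP /(K0_class_eq_iso cAB)[h hh].
have [C [D [V [m [j [r [p [i1 [i2 [p1 [p2 [BC BD bC bD _]]]]]]]]]]]] :=
  @quot_isom_lift A B sA hB X Y h hh.
exists (@K0_class (fullsub B) (exist _ D BD) - @K0_class (fullsub B) (exist _ C BC)).
rewrite K0_mapB /=; apply/eqP; rewrite subr_eq addrAC eq_sym subr_eq.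
by rewrite -(K0_class_biproduct bC) (K0_class_biproduct bD) addrC.
Qed.

Lemma K0_quotient_surjective (y : K0 (addquot B)) :
  exists x, K0_map (quotient_functor B) x = y.
Proof.
have [X [Y ->]] := K0_class_surj y.
by exists (K0_class (X : A) - K0_class (Y : A)); rewrite K0_mapB.
Qed.

End K0Exactness.

(** * The exact sequence *)

Theorem theoremA12 (A : addCat) (B : addSubcat A) (hA : krull_schmidt A)
  (hB : summand_closed B) :
  let e := inclusion B in
  let s := quotient_functor B in
  let zero : K1 (addquot B) -> K0 (fullsub B) := fun _ => 0 in
  [/\ exact_at 1%g (K1_map e) (K1_map s),
      exact_at 0 (K1_map s) zero,
      exact_at 0 zero (K0_map e),
      exact_at 0 (K0_map e) (K0_map s)
    & forall y : K0 (addquot B), exists x : K0 A, K0_map s x = y].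
Proof.
have lA W : local_sum W := krull_schmidt_local_sum W hA.
have cA := local_sums_cancellative lA; have sA := local_sums_split_monos lA.
have cAB : cancellative (addquot B).
  by apply: local_sums_cancellative => W; exact: local_sum_quot (lA W).
move=> e s zero; split.
- move=> x; split=> [|[n <-]]; first exact: K1_kernel.
  exact: K1_map_inclusion_quotient.
- by move=> y; split=> // _; exact: K1_quotient_surjective.
- move=> x; split=> [h|[c <-]].
    by exists 1%g; rewrite (K0_inclusion_inj cA h).
  by rewrite /zero -(subrr 0) K0_map_zmod_morphism subrr.
- move=> y; split=> [|[x <-]]; first exact: K0_kernel.
  exact: K0_map_inclusion_quotient.
- exact: K0_quotient_surjective.
Qed.
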